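(* Let $1\le p,q\le\infty$ be such that $1/p+1/q=1$ and such that $H^s(\Omega)$ is compactly embedded in $L^q(\Omega)$. Let $(u^n)$ be a sequence in $H^s(\Omega)$, $(\gamma^n)$ a sequence in $L^\infty(\Omega\times\Omega)$ of functions that are nonnegative and symmetric a.e. on $\Omega\times\Omega$, and $(p^n)$ a sequence in $L^p(\Omega)$, such that $u^n\rightharpoonup u$ weakly in $H^s(\Omega)$, $\gamma^n\rightharpoonup^*\gamma$ weakly-$*$ in $L^\infty(\Omega\times\Omega)$, $p^n\rightharpoonup p$ weakly in $L^p(\Omega)$ (for some $u\in H^s(\Omega)$, $\gamma\in L^\infty(\Omega\times\Omega)$, $p\in L^p(\Omega)$), and $$\langle u^n,v\rangle_{\gamma^n,s}=\langle p^n,v\rangle_{L^p(\Omega),L^q(\Omega)}\quad\text{for all } v\in H^s(\Omega)\text{ and all } n\in\mathbb N.$$ Then $$\langle u,v\rangle_{\gamma,s}=\langle p,v\rangle_{L^p(\Omega),L^q(\Omega)}\quad\text{for all } v\in H^s(\Omega)\qquad\text{and}\qquad \lim_{n\to\infty}|u^n|_{\gamma^n,s}^2=|u|_{\gamma,s}^2 .$$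
   Context: Let $s\in(0,1)$, $N\in\mathbb N$, and let $\Omega\subset\mathbb R^N$ be a nonempty, open, connected and bounded Lipschitz domain. For $\gamma\in L^\infty(\Omega\times\Omega)$ nonnegative and symmetric ($\gamma(x,y)=\gamma(y,x)$) a.e., and $u,v\in H^s(\Omega)$, $$\langle u,v\rangle_{\gamma,s}=\iint_{\Omega\times\Omega}\frac{(u(x)-u(y))(v(x)-v(y))}{|x-y|^{N+2s}}\gamma(x,y)\,dx\,dy,\qquad |u|_{\gamma,s}=\langle u,u\rangle_{\gamma,s}^{1/2}.$$ $H^s(\Omega)$ is the fractional Sobolev (Sobolev–Slobodeckij) space of all $u\in L^2(\Omega)$ with $|u|_{H^s(\Omega)}:=|u|_{\gamma,s}<\infty$ for $\gamma\equiv1$, with norm $\|u\|_{H^s(\Omega)}=(\|u\|_{L^2(\Omega)}^2+|u|_{H^s(\Omega)}^2)^{1/2}$. The duality pairing is $\langle p,v\rangle_{L^p(\Omega),L^q(\Omega)}=\int_\Omega p(x)v(x)\,dx$. *)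

(* Defs.v *)
From HB Require Import structures.
From mathcomp Require Import all_boot all_order all_algebra.
From mathcomp Require Import all_classical all_reals all_analysis.
Set Implicit Arguments.
Unset Strict Implicit.
Unset Printing Implicit Defensive.
Import Order.TTheory GRing.Theory Num.Theory.
Import numFieldNormedType.Exports.
Local Open Scope classical_set_scope.
Local Open Scope ring_scope.

Definition rV_display : measure_display. Proof. exact: default_measure_display. Qed.

(* The sigma-algebra on R^N generated by the coordinates is the Borel one. Every
   Lebesgue-measurable function has a Borel representative, so nothing is lost
   in the Lebesgue and Sobolev spaces below. *)
Section measurable_rV.
Context {R : realType}.
Variable N : nat.

Let coord (i : 'I_N) (x : 'rV[R]_N) : measurableTypeR R := x 0 i.

Let rV_set0 : g_sigma_preimage coord set0.
Proof. exact: sigma_algebra0. Qed.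

Let rV_setC A : g_sigma_preimage coord A -> g_sigma_preimage coord (~` A).
Proof. exact: sigma_algebraC. Qed.

Let rV_bigcup (F : (set 'rV[R]_N)^nat) :
  (forall i, g_sigma_preimage coord (F i)) ->
  g_sigma_preimage coord (\bigcup_i (F i)).
Proof. exact: sigma_algebra_bigcup. Qed.

HB.instance Definition _ := @isMeasurable.Build rV_display
  'rV[R]_N (g_sigma_preimage coord) rV_set0 rV_setC rV_bigcup.

Lemma measurable_rV_coord (i : 'I_N) :
  measurable_fun [set: 'rV[R]_N] (fun x => x 0 i : measurableTypeR R).
Proof.
move=> _ Y mY; rewrite setTI; apply: sub_sigma_algebra => /=.
rewrite -bigcup_seq/=; exists i => /=; first by rewrite mem_index_enum.
by exists Y => //; rewrite setTI.
Qed.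

Lemma measurable_fun_rV d (T : measurableType d) (f : T -> 'rV[R]_N) :
  (forall i, measurable_fun [set: T] (fun t => f t 0 i : measurableTypeR R)) ->
  measurable_fun [set: T] f.
Proof.
move=> mf _ A mA; rewrite setTI; move: A mA.
pose G : set (set 'rV[R]_N) := [set A | measurable (f @^-1` A)].
suff : g_sigma_preimage coord `<=` G by [].
apply: smallest_sub.
  split => [|A|F].
  - by rewrite /G /= preimage_set0.
  - by move=> GA; rewrite /G /= setTD -preimage_setC; exact: measurableC.
  - by move=> mF; rewrite /G /= preimage_bigcup; apply: bigcup_measurable => k _; exact: mF.
rewrite -bigcup_seq; apply: bigcup_sub => i _ _ [B mB <-].
by rewrite /G /= setTI; have := mf i measurableT B mB; rewrite setTI.
Qed.

End measurable_rV.

Section lebesgue_rV.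
Context {R : realType}.

Definition cons_rV n (z : measurableTypeR R * 'rV[R]_n) : 'rV[R]_n.+1 :=
  row_mx (z.1%:M : 'rV[R]_1) z.2.

Definition uncons_rV n (x : 'rV[R]_n.+1) : measurableTypeR R * 'rV[R]_n :=
  (x 0 0, rsubmx (x : 'rV[R]_(1 + n))).

Lemma cons_rV0 n (z : measurableTypeR R * 'rV[R]_n) : cons_rV z 0 0 = z.1.
Proof.
have -> : (0 : 'I_n.+1) = lshift n (0 : 'I_1) by exact/val_inj.
by rewrite (row_mxEl (z.1%:M : 'rV_1)) mxE eqxx mulr1n.
Qed.

Lemma cons_rVS n (z : measurableTypeR R * 'rV[R]_n) (i : 'I_n) :
  cons_rV z 0 (lift ord0 i) = z.2 0 i.
Proof.
have -> : lift ord0 i = rshift 1 i by exact/val_inj.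
by rewrite (row_mxEr (z.1%:M : 'rV_1)).
Qed.

Lemma cons_rVK n : cancel (@cons_rV n) (@uncons_rV n).
Proof.
move=> [a v]; rewrite /uncons_rV cons_rV0; congr pair.
by apply/rowP => i; rewrite mxE rshift1 cons_rVS.
Qed.

Lemma uncons_rVK n : cancel (@uncons_rV n) (@cons_rV n).
Proof.
move=> x; apply/rowP => i.
have [j ->|->] := unliftP ord0 i; last by rewrite cons_rV0.
by rewrite cons_rVS mxE rshift1.
Qed.

Lemma measurable_cons_rV n : measurable_fun setT (@cons_rV n).
Proof.
apply: measurable_fun_rV => i.
have [j ->|->] := unliftP ord0 i.
  under eq_fun do rewrite cons_rVS.
  apply: (measurableT_comp (measurable_rV_coord j)).
  exact: measurable_snd.
under eq_fun do rewrite cons_rV0.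
exact: measurable_fst.
Qed.

Lemma measurable_uncons_rV n : measurable_fun setT (@uncons_rV n).
Proof.
apply: measurable_fun_pair; first exact: measurable_rV_coord.
apply: measurable_fun_rV => i.
under eq_fun do rewrite mxE.
exact: measurable_rV_coord.
Qed.

Section step.
Variables (n : nat) (mu : {sigma_finite_measure set 'rV[R]_n -> \bar R}).

Definition lebesgue_rVS : set 'rV[R]_n.+1 -> \bar R :=
  pushforward (@lebesgue_measure R \x mu)%E (@cons_rV n).

Let mcons : measurable_fun setT (@cons_rV n) := @measurable_cons_rV n.

Let lebesgue_rVS0 : lebesgue_rVS set0 = 0%E.
Proof. by rewrite /lebesgue_rVS /pushforward preimage_set0 measure0. Qed.

Let lebesgue_rVS_ge0 A : (0 <= lebesgue_rVS A)%E.
Proof. exact: measure_ge0. Qed.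

Let lebesgue_rVS_sigma_additive : semi_sigma_additive lebesgue_rVS.
Proof. exact: measure_semi_sigma_additive. Qed.

HB.instance Definition _ := isMeasure.Build _ _ _ lebesgue_rVS
  lebesgue_rVS0 lebesgue_rVS_ge0 lebesgue_rVS_sigma_additive.

Let lebesgue_rVS_sigma_finite : sigma_finite setT lebesgue_rVS.
Proof.
have /sigma_finiteP[F [TF ndF Foo]] := sigma_finiteT (@lebesgue_measure R).
have /sigma_finiteP[G [TG ndG Goo]] := sigma_finiteT mu.
exists (fun k => @uncons_rV n @^-1` (F k `*` G k)).
  rewrite -preimage_bigcup (_ : \bigcup_k _ = setT) ?preimage_setT//.
  apply/seteqP; split => -[x y]// _.
  have [k _ Fkx] : (\bigcup_k F k) x by rewrite -TF.
  have [l _ Gly] : (\bigcup_k G k) y by rewrite -TG.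
  exists (maxn k l) => //; split => /=.
    by move: x Fkx; exact/subsetPset/ndF/leq_maxl.
  by move: y Gly; exact/subsetPset/ndG/leq_maxr.
move=> k; have [mF Fkoo] := Foo k; have [mG Gkoo] := Goo k; split.
  rewrite -[X in measurable X]setTI; apply: measurable_uncons_rV => //.
  exact: measurableX.
rewrite /lebesgue_rVS /pushforward (_ : _ @^-1` _ = F k `*` G k).
  by rewrite product_measure1E// lte_mul_pinfty// ge0_fin_numE.
by rewrite -comp_preimage (_ : _ \o _ = id)//; apply/funext => z; exact: cons_rVK.
Qed.

HB.instance Definition _ := Measure_isSigmaFinite.Build _ _ _ lebesgue_rVS
  lebesgue_rVS_sigma_finite.

End step.

Fixpoint lebesgue_rV n : {sigma_finite_measure set 'rV[R]_n -> \bar R} :=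
  if n is m.+1 then lebesgue_rVS (lebesgue_rV m) else \d_(0 : 'rV[R]_0).

Lemma lebesgue_rV_box n (A : 'I_n -> set (measurableTypeR R)) :
  (forall i, measurable (A i)) ->
  lebesgue_rV n [set x | forall i, A i (x 0 i)] =
  (\prod_(i < n) lebesgue_measure (A i))%E.
Proof.
elim: n A => [|n ih] A mA.
  by rewrite big_ord0 /= diracE mem_set// => -[].
rewrite big_ord_recl -ih//= /lebesgue_rVS /pushforward.
have mB : measurable [set x : 'rV[R]_n | forall i, A (lift ord0 i) (x 0 i)].
  rewrite (_ : mkset _ =
      \big[setI/setT]_(i < n) ((fun x : 'rV[R]_n => x 0 i) @^-1` A (lift ord0 i))).
    apply: bigsetI_measurable => i _.
    rewrite -[X in measurable X]setTI; exact: measurable_rV_coord.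
  by apply/seteqP; split => x /=; rewrite -bigcap_seq /= => h i;
    [move=> _|]; apply: h => //=; rewrite mem_index_enum.
rewrite -product_measure1E//; congr (_ _).
apply/seteqP; split => -[a v] /= h.
  split; first by have := h ord0; rewrite cons_rV0.
  by move=> i; have := h (lift ord0 i); rewrite cons_rVS.
move=> i; have [j ->|->] := unliftP ord0 i; last by rewrite cons_rV0; exact: h.1.
by rewrite cons_rVS; exact: h.2.
Qed.

End lebesgue_rV.

Section weak_convergence.
Context {R : realType} {V : lmodType R}.
Implicit Types (X Y : set V) (nX nY : V -> R).

(* A normed function space is given by the set [X] of its representatives and
   its norm [nX], a seminorm vanishing exactly on the representatives of 0.
   Boundedness with respect to [nX] makes [phi] constant on almost-everywhere
   classes, so that [dual X nX] is the topological dual of the quotient. *)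
Definition dual X nX : set (V -> R) := [set phi |
  (forall a f g, X f -> X g -> phi (a *: f + g) = a * phi f + phi g) /\
  exists C : R, forall f, X f -> `|phi f| <= C * nX f].

Definition weak_cvg X nX (f_ : V^nat) (f : V) : Prop :=
  forall phi, dual X nX phi -> phi (f_ n) @[n --> \oo] --> phi f.

Definition compactly_embedded X nX Y nY : Prop :=
  [/\ X `<=` Y,
      exists C : R, forall f, X f -> nY f <= C * nX f &
      forall f_ : V^nat, (forall n, X (f_ n)) ->
        (exists M : R, forall n, nX (f_ n) <= M) ->
        exists (k : nat -> nat) (g : V), [/\ {homo k : m n / (m < n)%N}, Y g &
          nY (f_ (k n) - g) @[n --> \oo] --> (0 : R)]].

End weak_convergence.

Section Lebesgue_spaces.
Context {d} {T : measurableType d} {R : realType}.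
Variables (mu : {measure set T -> \bar R}) (D : set T).

(* Functions on [D] are represented by functions on [T], of which only the
   restriction to [D] (extended by 0) is taken into account. *)
Definition Lfun_on (p : \bar R) : set (T -> R) :=
  [set f | f \_ D \in Lfun mu p].

Definition Lnorm_on (p : \bar R) (f : T -> R) : R :=
  fine ('N[mu]_p[EFin \o (f \_ D)])%E.

Definition pairing (f g : T -> R) : R := \int[mu]_(x in D) (f x * g x).

(* L^oo as the dual of L^1 *)
Definition weak_star_cvg (f_ : (T -> R)^nat) (f : T -> R) : Prop :=
  forall g, Lfun_on 1 g -> pairing (f_ n) g @[n --> \oo] --> pairing f g.

End Lebesgue_spaces.

Section domains.
Context {R : realType}.

(* The library norm on row vectors is the maximum norm. *)
Definition euclidean_norm N (x : 'rV[R]_N) : R :=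
  Num.sqrt (\sum_(i < N) x 0 i ^+ 2).

(* Near every boundary point, up to an orthogonal change of coordinates,
   [Omega] is the strict epigraph of a Lipschitz function of N - 1 variables,
   the i-th coordinate being the vertical one. *)
Definition lipschitz_boundary N (Omega : set 'rV[R]_N) : Prop :=
  forall x0, (closure Omega `\` interior Omega) x0 ->
  exists (r : R) (A : 'M[R]_N) (i : 'I_N) (phi : 'rV[R]_N.-1 -> R) (L : R),
    [/\ 0 < r, A *m A^T = 1%:M, L.-lipschitz (phi : _ -> R^o) &
      forall x, euclidean_norm (x - x0) < r ->
        (Omega x <-> phi (col' i (x *m A)) < (x *m A) 0 i)].

Definition bounded_lipschitz_domain N (Omega : set 'rV[R]_N) : Prop :=
  [/\ Omega !=set0, open Omega, connected Omega, bounded_set Omega &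
      lipschitz_boundary Omega].

End domains.

Section fractional_Sobolev.
Context {R : realType}.
Variables (N : nat) (Omega : set 'rV[R]_N) (s : R).
Implicit Types (u v : 'rV[R]_N -> R) (gamma : 'rV[R]_N * 'rV[R]_N -> R).

Definition lebesgue_rV2 : {measure set ('rV[R]_N * 'rV[R]_N) -> \bar R} :=
  (lebesgue_rV N \x lebesgue_rV N)%E.

Definition Hs_integrand gamma u v (z : 'rV[R]_N * 'rV[R]_N) : R :=
  (u z.1 - u z.2) * (v z.1 - v z.2) /
    euclidean_norm (z.1 - z.2) `^ (N%:R + 2 * s) * gamma z.

Definition Hs_form gamma u v : R :=
  \int[lebesgue_rV2]_(z in Omega `*` Omega) Hs_integrand gamma u v z.

Definition Hs_seminorm gamma u : R := Num.sqrt (Hs_form gamma u u).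

Definition Hs : set ('rV[R]_N -> R) := [set u |
  Lfun_on (lebesgue_rV N) Omega 2%:E u /\
  (\int[lebesgue_rV2]_(z in Omega `*` Omega)
     (Hs_integrand (cst 1%R) u u z)%:E < +oo)%E].

Definition Hs_norm u : R :=
  Num.sqrt (Lnorm_on (lebesgue_rV N) Omega 2%:E u ^+ 2 +
            Hs_seminorm (cst 1) u ^+ 2).

Definition nonneg_symmetric_ae gamma : Prop :=
  {ae lebesgue_rV2, forall z, (Omega `*` Omega) z ->
     0 <= gamma z /\ gamma (z.1, z.2) = gamma (z.2, z.1)}.

End fractional_Sobolev.

(* Main.v *)
(* Write G u (x, y) = (u x - u y) / |x - y|^(N/2 + s), so that the form
   <u, v>_gamma is the integral of gamma * G u * G v. By the uniform boundedness
   principle the u_n are bounded in H^s, the gamma_n as functionals on L^1, and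
   the p_n as functionals on L^q. Compactness turns the weak convergence of u_n
   into strong convergence in L^q, hence in L^1. As the form is nonlocal, this
   is enough for G u_n * G v --> G u * G v strongly in L^1: on the set where
   |G v| / |x - y|^(N/2 + s) <= k the difference is controlled by the L^1 norm of
   u_n - u, elsewhere by the Cauchy-Schwarz inequality. Strong convergence
   against the weak-* limit of gamma_n gives the equation for u. Testing with
   u_n itself, |u_n|^2_gamma_n = <p_n, u_n> --> <p, u> = |u|^2_gamma. *)
Require Import Defs.
From mathcomp Require Import all_boot all_order all_algebra.
From mathcomp Require Import all_classical all_reals all_analysis.
From mathcomp Require Import measurable_realfun ess_sup_inf.
From mathcomp Require Import ring lra.
Set Implicit Arguments.
Unset Strict Implicit.
Unset Printing Implicit Defensive.
Import Order.TTheory GRing.Theory Num.Theory.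
Import numFieldNormedType.Exports.
Local Open Scope classical_set_scope.
Local Open Scope ring_scope.

(** The obstacle is a product of weak limits: [gamma_ n] converges only weakly-star and G u_n only
    weakly in L^2, so neither factor of gamma_n * G u_n * G v is strong by itself. Fixing v helps,
    but the kernel in G blows up at the diagonal, so L^1 smallness of u_n - u does not control G
    (u_n - u) * G v directly; hence the cut at level k. Spaces are sets of representatives with
    seminorms, so the uniform boundedness principle is stated for real functions on a bare type, its
    only structural input being sums of signed geometric series. For u_n and p_n these sums are
    formed in the dual, where pointwise limits suffice; for gamma_n the test functions lie in L^1
    itself, and their series are summed explicitly. Except for u_n, where the inner product returns
    the norm, the resulting bounds stay bounds on functionals, the form in which they are used.
    Passing from L^q to L^1 on the finite-measure set Omega makes the limit argument for the form
    independent of the exponents, endpoints included. *)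

(** * Uniform boundedness by a gliding hump *)

Section uniform_boundedness.
Context {R : realType} {E : Type}.
Variables (B : set E) (L : nat -> E -> R).

(** The supremum need not be attained; a nonzero value makes it positive, so half of it lies
    strictly below and is exceeded by some [e]. *)
Lemma near_maximizer n C : (exists2 e, B e & 0 < `|L n e|) ->
  (forall e, B e -> `|L n e| <= C) ->
  exists2 e, B e & forall e', B e' -> `|L n e'| <= 2 * `|L n e|.
Proof.
move=> [e0 Be0 Le0] LC; pose S := [set `|L n e| | e in B].
have supS : has_sup S.
  by split; [exists `|L n e0|, e0|exists C => _ [e Be <-]; exact: LC].
have S0 : 0 < sup S by apply: (lt_le_trans Le0); apply: ub_le_sup; [exact: supS.2|exists e0].
have [_ [e Be <-] eS] : exists2 x, S x & sup S - sup S / 2 < x.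
  by apply: sup_adherent => //; rewrite divr_gt0.
exists e => // e' Be'; have : `|L n e'| <= sup S.
  by apply: ub_le_sup; [exact: supS.2|exists e'].
lra.
Qed.

Variables (e : nat -> E) (m : nat -> nat).

(** [E] has no addition, so the partial sums of the hump series are recorded only through the values
    that each [L n] would take on them. The j-th sign is decided at the functional [m j] and is
    therefore the same for all [n]: it is negative exactly when adding the j-th term would leave
    less than the modulus of that term. *)
Fixpoint signed_sum k (n : nat) : R :=
  if k is j.+1 then signed_sum j n +
    (-1) ^+ (`|signed_sum j (m j) + 4^-1 ^+ j * L (m j) (e j)| <
             4^-1 ^+ j * `|L (m j) (e j)|)%R * 4^-1 ^+ j * L n (e j)
  else 0.

Definition signs j : bool :=
  `|signed_sum j (m j) + 4^-1 ^+ j * L (m j) (e j)| < 4^-1 ^+ j * `|L (m j) (e j)|.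

Lemma signed_sumE k n : signed_sum k n =
  \sum_(j < k) (-1) ^+ signs j * 4^-1 ^+ j * L n (e j).
Proof. by elim: k => [|k ih]; rewrite ?big_ord0// big_ord_recr/= ih. Qed.

(* One of the two signs does not decrease the modulus:
   max(|a + b|, |a - b|) >= |b|. *)
Lemma signed_sum_ge k :
  4^-1 ^+ k * `|L (m k) (e k)| <= `|signed_sum k.+1 (m k)|.
Proof.
rewrite /=; set a := signed_sum k (m k); set x := L (m k) (e k).
set c := 4^-1 ^+ k.
have c0 : 0 <= c by rewrite exprn_ge0.
have -> : c * `|x| = `|c * x| by rewrite normrM (ger0_norm c0).
case: ltP => [ab|]; last by rewrite expr0 mul1r.
rewrite expr1 !mulN1r mulNr; move: ab; set b := c * x => ab.
have := ler_normB (a + b) (a - b).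
rewrite (_ : a + b - (a - b) = b *+ 2); last by rewrite mulr2n; ring.
rewrite normrMn mulr2n; lra.
Qed.

(** 4/3 * (4^-k - 4^-l) is the exact value of the sum of 4^-j for k <= j < l, which lets the
    induction on [l] close. *)
Lemma signed_sum_tail n C k l : (forall j, `|L n (e j)| <= C) -> (k <= l)%N ->
  `|signed_sum l n - signed_sum k n| <=
    4 / 3 * C * (4^-1 ^+ k - 4^-1 ^+ l).
Proof.
move=> LC; elim: l => [|l ih]; first by rewrite leqn0 => /eqP ->; rewrite !subrr normr0 mulr0.
rewrite leq_eqVlt => /predU1P[->|]; first by rewrite !subrr normr0 mulr0.
rewrite ltnS => /ih {}ih; rewrite /= addrAC.
apply: (le_trans (ler_normD _ _)).
have -> : 4 / 3 * C * (4^-1 ^+ k - 4^-1 ^+ l.+1) =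
   4 / 3 * C * (4^-1 ^+ k - 4^-1 ^+ l) + 4^-1 ^+ l * C :> R by rewrite exprS; field.
apply: lerD => //; rewrite !normrM normr_sign mul1r.
by rewrite ger0_norm ?exprn_ge0// ler_wpM2l// exprn_ge0.
Qed.

End uniform_boundedness.

(* Sokal's gliding hump: no Baire category argument is needed, and
   completeness enters only through the sums of geometric series in [B]. *)
Lemma uniform_boundedness {R : realType} (E : Type) (B : set E)
    (L : nat -> E -> R) :
  (forall n, exists C, forall e, B e -> `|L n e| <= C) ->
  (forall (e : nat -> E) (b : nat -> bool), (forall k, B (e k)) ->
    exists x, (exists M, forall n, `|L n x| <= M) /\
      forall n, (\sum_(j < k) (-1) ^+ b j * 4^-1 ^+ j * L n (e j)) @[k --> \oo]
        --> L n x) ->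
  exists C, forall n e, B e -> `|L n e| <= C.
Proof.
move=> LC sumL; apply: contrapT => /forallNP unb.
(* The growth 8^k outruns the weights 4^-k: the weighted humps still grow like 2^k. *)
have pick k : exists ne : nat * E, [/\ B ne.2, (8 ^+ k : R) <= 2 * `|L ne.1 ne.2| &
    forall e', B e' -> `|L ne.1 e'| <= 2 * `|L ne.1 ne.2|].
  have /existsNP[n /existsNP[e0 /not_implyP[Be0 /negP]]] := unb (8 ^+ k).
  rewrite -ltNge => Le0; have [C LnC] := LC n.
  have [e Be emax] : exists2 e, B e & forall e', B e' -> `|L n e'| <= 2 * `|L n e|.
    apply: near_maximizer LnC; exists e0 => //.
    by rewrite (le_lt_trans _ Le0)// exprn_ge0.
  exists (n, e); split => //=.
  by rewrite (le_trans (ltW Le0))// emax.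
have [ne neP] := choice pick.
pose e k := (ne k).2; pose m k := (ne k).1.
have Be k : B (e k) by case: (neP k).
have [x [[M LM] Lx]] := sumL e (signs L e m) Be.
(* With y = |L (m k) (e k)|, the sum up to the k-th term has modulus at least 4^-k * y.
   Near-maximality bounds every later term by the weight times 2 * y, so the tail is at most 4/3 * 2
   * 4^-(k+1) * y = 2/3 * 4^-k * y, and a third of the hump survives. *)
have big k : 4^-1 ^+ k * `|L (m k) (e k)| / 3 <= M.
  have [_ _ emax] := neP k.
  apply: le_trans (LM (m k)).
  have cv : signed_sum L e m l (m k) @[l --> \oo] --> L (m k) x.
    by under eq_fun do rewrite signed_sumE; exact: Lx.
  have tail : `|L (m k) x - signed_sum L e m k.+1 (m k)| <=
      4 / 3 * (2 * `|L (m k) (e k)|) * 4^-1 ^+ k.+1.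
    have cv' : `|signed_sum L e m l (m k) - signed_sum L e m k.+1 (m k)| @[l --> \oo]
        --> `|L (m k) x - signed_sum L e m k.+1 (m k)|.
      by apply: cvg_norm; apply: cvgB => //; exact: cvg_cst.
    rewrite -(cvg_lim _ cv')//; apply: limr_le; first by apply/cvg_ex; eexists; exact: cv'.
    near=> l; apply: le_trans; first apply: (@signed_sum_tail _ _ _ _ _ _ (2 * `|L (m k) (e k)|)).
    - by move=> j; apply: emax.
    - by near: l; exact: nbhs_infty_ge.
    - apply: ler_wpM2l; first by rewrite !mulr_ge0.
      by rewrite gerBl exprn_ge0.
  have := signed_sum_ge L e m k.
  have := lerB_dist (signed_sum L e m k.+1 (m k)) (L (m k) x).
  rewrite distrC; move: tail; rewrite exprS.
  rewrite (_ : 4 / 3 * (2 * `|L (m k) (e k)|) * (4^-1 * 4^-1 ^+ k) =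
     2 / 3 * (4^-1 ^+ k * `|L (m k) (e k)|)); last by field.
  move: (signed_sum _ _ _ _ _) => S.
  lra.
have M0 : 0 <= M by exact: le_trans (LM 0%N).
(* Since 8^k <= 2 * y and 4^-k * y / 3 <= M, one gets 2^k <= 2 * 4^-k * y <= 6 * M. *)
have [k Mk] : exists k : nat, 6 * M < 2 ^+ k.
  exists (Num.truncn (6 * M)).+1.
  apply: (lt_le_trans (truncnS_gt _)).
  by rewrite -natrX ler_nat ltnW// ltn_expl.
have [_ h8 _] := neP k; have := big k; move: h8; rewrite -/(m k) -/(e k).
set y := `|L _ _| => h8.
have : 2 ^+ k <= 4^-1 ^+ k * (2 * y).
  apply: le_trans (ler_wpM2l _ h8); last by rewrite exprn_ge0.
  by rewrite -exprMn (_ : 4^-1 * 8 = 2)//; field.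
set t := 4^-1 ^+ k; have -> : t * (2 * y) = 2 * (t * y) by ring.
lra.
Unshelve. all: by end_near.
Qed.

(** * Lebesgue spaces on a measurable subset: linear structure, Hölder inequality, pairing *)

Section Lfun_on_theory.
Context {d} {T : measurableType d} {R : realType}.
Variables (mu : {measure set T -> \bar R}) (D : set T).
Hypothesis mD : measurable D.
Implicit Types (f g h : T -> R) (p q : \bar R).

Lemma Lfun_onE p f : Lfun_on mu D p f <->
  measurable_fun D f /\ ('N[mu]_p[EFin \o (f \_ D)] < +oo)%E.
Proof.
rewrite /Lfun_on /= inE; split.
  by move=> /andP[]; rewrite !inE/= => mf nf; split => //; exact/(measurable_restrictT _ mD).
move=> [mf nf]; apply/andP; rewrite !inE/=; split => //.
exact/(measurable_restrictT _ mD).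
Qed.

Lemma Lfun_on_measurable p f : Lfun_on mu D p f -> measurable_fun D f.
Proof. by case/Lfun_onE. Qed.

Lemma Lnorm_on_ge0 p f : 0 <= Lnorm_on mu D p f.
Proof. exact/fine_ge0/Lnorm_ge0. Qed.

Lemma Lnorm_onK p f : Lfun_on mu D p f ->
  ((Lnorm_on mu D p f)%:E = 'N[mu]_p[EFin \o (f \_ D)])%E.
Proof. by move=> /Lfun_onE[_ nf]; rewrite fineK// ge0_fin_numE// Lnorm_ge0. Qed.

Lemma restrictZD a f g : (a *: f + g) \_ D = a *: (f \_ D) + g \_ D.
Proof.
apply/funext => x; rewrite !fctE /patch; case: ifPn => //.
by rewrite scaler0 addr0.
Qed.

Lemma Lfun_onZD p a f g : (1 <= p)%E -> Lfun_on mu D p f ->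
  Lfun_on mu D p g -> Lfun_on mu D p (a *: f + g).
Proof.
move=> p1 pf pg; rewrite /Lfun_on /= restrictZD.
exact: (Lfun_submod_closed mu p1).2.
Qed.

Lemma Lfun_on0 p : (1 <= p)%E -> Lfun_on mu D p 0.
Proof.
move=> p1; rewrite /Lfun_on /= (_ : 0 \_ D = 0).
  exact: (Lfun_submod_closed mu p1).1.
by apply/funext => x; rewrite /patch; case: ifPn.
Qed.

Lemma Lfun_onZ p a f : (1 <= p)%E -> Lfun_on mu D p f -> Lfun_on mu D p (a *: f).
Proof. by move=> p1 pf; rewrite -[_ *: _]addr0; apply: Lfun_onZD => //; exact: Lfun_on0. Qed.

Lemma Lfun_onB p f g : (1 <= p)%E -> Lfun_on mu D p f ->
  Lfun_on mu D p g -> Lfun_on mu D p (f - g).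
Proof. by move=> p1 pf pg; rewrite -scaleN1r addrC; exact: Lfun_onZD. Qed.

Lemma Lnorm_onD p f g : (1 <= p)%E -> Lfun_on mu D p f -> Lfun_on mu D p g ->
  Lnorm_on mu D p (f + g) <= Lnorm_on mu D p f + Lnorm_on mu D p g.
Proof.
move=> p1 pf pg; have pfg : Lfun_on mu D p (f + g).
  by rewrite -[f]scale1r; exact: Lfun_onZD.
rewrite -lee_fin EFinD !Lnorm_onK// -[in leLHS](scale1r f) restrictZD scale1r.
by apply: eminkowski => //; apply/(measurable_restrictT _ mD);
  [exact: Lfun_on_measurable pf|exact: Lfun_on_measurable pg].
Qed.

Lemma Lnorm_onZ p a f : (1 <= p)%E -> Lfun_on mu D p f ->
  Lnorm_on mu D p (a *: f) = `|a| * Lnorm_on mu D p f.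
Proof.
move=> p1 pf; apply: EFin_inj; rewrite EFinM !Lnorm_onK//; last exact: Lfun_onZ.
have -> : (a *: f) \_ D = a *: (f \_ D).
  by apply/funext => x; rewrite !fctE /patch; case: ifPn => //; rewrite scaler0.
have := LnormZ (Lfun_Sub p1 pf) a.
by [].
Qed.

Lemma Lfun_on1P f : Lfun_on mu D 1 f <-> mu.-integrable D (EFin \o f).
Proof.
rewrite integrable_mkcond// restrict_EFin; exact: Lfun1_integrable.
Qed.

Lemma Lnorm_on1 f : Lnorm_on mu D 1 f = \int[mu]_(x in D) `|f x|.
Proof.
rewrite /Lnorm_on Lnorm1 Rintegral_mkcond; congr fine.
by apply: eq_integral => x _; rewrite /= /patch; case: ifPn => //; rewrite normr0.
Qed.

Lemma Lfun_on_ae_bounded g : Lfun_on mu D +oo g ->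
  exists2 M, 0 <= M & {ae mu, forall x, D x -> `|g x| <= M}.
Proof.
(* The L^oo norm is an essential supremum only when the whole space has positive measure; otherwise
   it is 0 by convention and every almost-everywhere bound is trivial. *)
move=> /Lfun_onE[mg]; rewrite unlock /Lnorm; case: ifPn => [_|mu0 _]; last first.
  exists 0 => //; exists setT; split => //.
  by apply/eqP; rewrite eq_le measure_ge0 leNgt mu0.
move=> /ess_supr_bounded[M gM]; exists `|M| => //.
apply: filterS gM => x /= + Dx; rewrite /patch mem_set// => h.
exact: le_trans (ler_norm _).
Qed.

Lemma ae_bounded_Lfun_on g M : measurable_fun D g ->
  {ae mu, forall x, D x -> `|g x| <= M} -> Lfun_on mu D +oo g.
Proof.
move=> mg gM; apply/Lfun_onE; split => //; rewrite unlock /Lnorm.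
case: ifPn => // _; apply: (@le_lt_trans _ _ `|M|%:E); last exact: ltry.
apply/ess_supP; apply: filterS gM => x /= gM; rewrite lee_fin /patch.
case: ifPn => [/set_mem/gM h|_]; last by rewrite normr0.
exact: le_trans (ler_norm _).
Qed.

Lemma integrable_bounded_mul f g M : measurable_fun D f ->
  mu.-integrable D (EFin \o g) -> {ae mu, forall x, D x -> `|f x| <= M} ->
  mu.-integrable D (EFin \o (f \* g)) /\
  \int[mu]_(x in D) `|f x * g x| <= `|M| * \int[mu]_(x in D) `|g x|.
Proof.
move=> mf ig fM; have mg : measurable_fun D g by exact/measurable_EFinP/(measurable_int mu).
have gint : mu.-integrable D (fun x => (`|M| * `|g x|)%:E).
  exact: (@integrableZl _ _ _ mu D mD `|M| _ (integrable_norm ig)).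
have le : (\int[mu]_(x in D) `|f x * g x|%:E <= \int[mu]_(x in D) (`|M| * `|g x|)%:E)%E.
  apply: ae_ge0_le_integral => //.
  - apply/measurable_EFinP; apply: measurableT_comp => //; exact: measurable_funM.
  - exact: (measurable_int mu).
  - apply: filterS fM => x /= + Dx => /(_ Dx) h; rewrite lee_fin normrM ler_wpM2r//.
    exact: le_trans (ler_norm _).
have fg : mu.-integrable D (EFin \o (f \* g)).
  apply/integrableP; split; first by apply/measurable_EFinP; exact: measurable_funM.
  apply: le_lt_trans le _; have /integrableP[_] := gint.
  by under eq_integral do rewrite gee0_abs ?lee_fin ?mulr_ge0//.
split => //; rewrite -RintegralZl//; last exact: (integrable_norm ig).
rewrite -lee_fin /Rintegral !fineK//; first exact: integrable_fin_num.
by apply: integrable_fin_num => //; exact: (integrable_norm fg).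
Qed.

(** Two finite exponents give the usual inequality for the restrictions extended by 0. The endpoint
    pairs both reduce to [Loo], an essential bound on one factor, up to exchanging the factors. *)
Lemma hoelder_on p q f g : (1 <= p)%E -> (1 <= q)%E -> (p^-1 + q^-1 = 1)%E ->
  Lfun_on mu D p f -> Lfun_on mu D q g ->
  mu.-integrable D (EFin \o (f \* g)) /\
  \int[mu]_(x in D) `|f x * g x| <= Lnorm_on mu D p f * Lnorm_on mu D q g.
Proof.
move=> p1 q1 pq pf qg.
have mf := Lfun_on_measurable pf; have mg := Lfun_on_measurable qg.
have mfg : measurable_fun D (f \* g) by exact: measurable_funM.
have fgD : (f \* g)%R \_ D = ((f \_ D) \* (g \_ D))%R.
  by apply/funext => x; rewrite /= /patch; case: ifPn => //; rewrite mul0r.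
suff H : ('N[mu]_1[EFin \o ((f \* g)%R \_ D)] <=
    'N[mu]_p[EFin \o (f \_ D)] * 'N[mu]_q[EFin \o (g \_ D)])%E.
  have fg1 : Lfun_on mu D 1 (f \* g).
    apply/Lfun_onE; split => //; apply: le_lt_trans H _.
    by rewrite -!Lnorm_onK// -EFinM ltry.
  split; first exact/Lfun_on1P.
  rewrite -Lnorm_on1 -lee_fin EFinM !Lnorm_onK//.
have Loo f' g' : Lfun_on mu D +oo f' -> Lfun_on mu D 1 g' ->
  ('N[mu]_1[EFin \o ((f' \* g')%R \_ D)] <=
    'N[mu]_+oo[EFin \o (f' \_ D)] * 'N[mu]_1[EFin \o (g' \_ D)])%E.
  move=> f'oo g'1; have /Lfun_on1P ig := g'1.
  have mf' := Lfun_on_measurable f'oo.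
  have f'M : {ae mu, forall x, D x -> `|f' x| <= Lnorm_on mu D +oo f'}.
    have [mu0|mu0] := ltP 0%E (mu setT); last first.
      by exists setT; split => //; apply/eqP; rewrite eq_le mu0 measure_ge0.
    have := ess_sup_ge mu (abse \o (EFin \o (f' \_ D))).
    apply: filterS => x /= + Dx; rewrite -lee_fin Lnorm_onK//.
    by rewrite unlock /Lnorm mu0 /= {1}/patch mem_set.
  have [fg le] := integrable_bounded_mul mf' ig f'M.
  rewrite -Lnorm_onK; last exact/Lfun_on1P.
  rewrite -(Lnorm_onK f'oo) -(Lnorm_onK g'1) -EFinM lee_fin !Lnorm_on1.
  by rewrite -[X in _ <= X * _]ger0_norm// Lnorm_on_ge0.
have fgC f' g' : (f' \* g')%R = (g' \* f')%R :> (T -> R).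
  by apply/funext => x /=; rewrite mulrC.
case: p q p1 q1 pq pf qg => [p| |] [q| |]//= p1 q1.
- have p0 : 0 < p by rewrite (lt_le_trans ltr01).
  have q0 : 0 < q by rewrite (lt_le_trans ltr01).
  rewrite !inver !gt_eqF// -EFinD => -[pq] _ _.
  by rewrite fgD; apply: hoelder => //; exact/(measurable_restrictT _ mD).
- by rewrite invey adde0 => /eqP; rewrite inve_eq1 => /eqP -> pf qg; rewrite fgC muleC; exact: Loo.
- by rewrite invey add0e => /eqP; rewrite inve_eq1 => /eqP -> pf qg; exact: Loo.
- by rewrite invey adde0 => /eqP; rewrite eq_sym onee_eq0.
Qed.

Lemma pairing_le p q f g : (1 <= p)%E -> (1 <= q)%E -> (p^-1 + q^-1 = 1)%E ->
  Lfun_on mu D p f -> Lfun_on mu D q g ->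
  `|pairing mu D f g| <= Lnorm_on mu D p f * Lnorm_on mu D q g.
Proof.
move=> p1 q1 pq pf qg; have [ifg le] := hoelder_on p1 q1 pq pf qg.
by apply: le_trans le; exact: le_normr_Rintegral.
Qed.

Lemma pairingC f g : pairing mu D f g = pairing mu D g f.
Proof. by apply: eq_Rintegral => x _; rewrite mulrC. Qed.

Lemma pairingZD a f g h : mu.-integrable D (EFin \o (f \* h)) ->
  mu.-integrable D (EFin \o (g \* h)) ->
  pairing mu D (a *: f + g) h = a * pairing mu D f h + pairing mu D g h.
Proof.
move=> fh gh; rewrite /pairing -RintegralZl// -RintegralD//.
  apply: eq_Rintegral => x _; have -> : (a *: f + g) x = a * f x + g x by [].
  by rewrite mulrDl mulrA.
exact: (@integrableZl _ _ _ mu D mD a _ fh).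
Qed.

Lemma pairingBl f g h : mu.-integrable D (EFin \o (f \* h)) ->
  mu.-integrable D (EFin \o (g \* h)) ->
  pairing mu D (f - g) h = pairing mu D f h - pairing mu D g h.
Proof.
by move=> fh gh; rewrite addrC -scaleN1r pairingZD// mulN1r addrC.
Qed.

Lemma pairingBr f g h : mu.-integrable D (EFin \o (h \* f)) ->
  mu.-integrable D (EFin \o (h \* g)) ->
  pairing mu D h (f - g) = pairing mu D h f - pairing mu D h g.
Proof.
have C f' : (EFin \o (h \* f'))%R = (EFin \o (f' \* h))%R.
  by apply/funext => x /=; rewrite mulrC.
by rewrite !C => hf hg; rewrite pairingC pairingBl// ![pairing _ _ h _]pairingC.
Qed.

Lemma Lfun_on2P f : Lfun_on mu D 2%:E f <->
  measurable_fun D f /\ (\int[mu]_(x in D) (f x ^+ 2)%:E < +oo)%E.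
Proof.
have E : ('N[mu]_2%:E[EFin \o (f \_ D)] `^ 2 = \int[mu]_(x in D) (f x ^+ 2)%:E)%E.
  rewrite poweR_Lnorm// [RHS]integral_mkcond; apply: eq_integral => x _ /=.
  rewrite /patch; case: ifPn => _; last by rewrite normr0 powR0.
  by rewrite powR_mulrn// real_normK// num_real.
rewrite Lfun_onE -E; split => -[mf nf]; split => //.
  exact: poweR_lty.
exact: lty_poweRy nf.
Qed.

Lemma Lnorm_on2 f : Lfun_on mu D 2%:E f ->
  Lnorm_on mu D 2%:E f ^+ 2 = \int[mu]_(x in D) (f x ^+ 2).
Proof.
move=> f2; have [mf fin] := (Lfun_on2P f).1 f2.
apply: EFin_inj; rewrite /Rintegral fineK; last first.
  by rewrite ge0_fin_numE// integral_ge0// => x _; rewrite lee_fin sqr_ge0.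
transitivity ((Lnorm_on mu D 2%:E f)%:E `^ 2)%E.
  by rewrite poweR_EFin powR_mulrn// Lnorm_on_ge0.
rewrite Lnorm_onK// poweR_Lnorm// [RHS]integral_mkcond; apply: eq_integral => x _ /=.
rewrite /patch; case: ifPn => _; last by rewrite normr0 powR0.
by rewrite powR_mulrn// real_normK// num_real.
Qed.

Lemma Lfun_on_bounded_finite p f M : (1 <= p)%E -> (mu D < +oo)%E ->
  measurable_fun D f -> (forall x, D x -> `|f x| <= M) -> Lfun_on mu D p f.
Proof.
case: p => [p| |]// p1 Dfin mf fM; last first.
  by apply: (@ae_bounded_Lfun_on _ M) => //; exact: aeW.
have p0 : 0 < p by rewrite (lt_le_trans ltr01).
apply/Lfun_onE; split => //; apply: (@lty_poweRy _ _ p); first by rewrite gt_eqF.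
rewrite poweR_Lnorm ?gt_eqF//.
apply: (@le_lt_trans _ _ (\int[mu]_(x in D) (`|M| `^ p)%:E)%E); last first.
  by rewrite integral_cst//= lte_mul_pinfty// lee_fin powR_ge0.
rewrite [leRHS]integral_mkcond; apply: ge0_le_integral => //.
- by move=> x _; rewrite poweR_ge0.
- apply: (measurableT_comp (measurable_poweR _)); apply: measurableT_comp => //.
  by exact/measurable_EFinP/(measurable_restrictT _ mD).
- exact/(measurable_restrictT _ mD).1.
- move=> x _ /=; rewrite /patch; case: ifPn => [/set_mem Dx|_].
    rewrite lee_fin; apply: ge0_ler_powR; rewrite ?nnegrE//; first exact: ltW.
    exact: le_trans (fM _ Dx) (ler_norm _).
  (* Off [D] both restrictions take the default value [point], which is 0 in [R] and in [\bar R]. *)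
  by rewrite (_ : point = 0 :> R)// (_ : point = 0%E :> \bar R)// normr0 powR0// gt_eqF.
Qed.

End Lfun_on_theory.

(** * Signed geometric series and boundedness of weakly convergent sequences *)

Lemma signed_geometric_sum_le {R : realType} (a : nat -> R) (b : nat -> bool) C k :
  (forall j, `|a j| <= C) ->
  \sum_(j < k) `|(-1) ^+ b j * 4^-1 ^+ j * a j| <= 4 / 3 * C.
Proof.
move=> aC; have C0 : 0 <= C by exact: le_trans (aC 0%N).
(* The bound 4/3 * C is not inductive; the exact geometric sum is. *)
suff : \sum_(j < k) `|(-1) ^+ b j * 4^-1 ^+ j * a j| <= 4 / 3 * C * (1 - 4^-1 ^+ k).
  move/le_trans; apply; rewrite -[leRHS]mulr1; apply: ler_wpM2l; first by rewrite !mulr_ge0.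
  by rewrite gerBl exprn_ge0.
elim: k => [|k ih]; first by rewrite big_ord0 expr0 subrr mulr0.
rewrite big_ord_recr /=.
have -> : 4 / 3 * C * (1 - 4^-1 ^+ k.+1) =
   4 / 3 * C * (1 - 4^-1 ^+ k) + 4^-1 ^+ k * C :> R by rewrite exprS; field.
apply: lerD => //; rewrite !normrM normr_sign mul1r.
by rewrite ger0_norm ?exprn_ge0// ler_wpM2l// exprn_ge0.
Qed.

Lemma abs_summable_cvgn {R : realType} (a : nat -> R) M :
  (forall k, \sum_(j < k) `|a j| <= M) -> cvgn (fun k => \sum_(j < k) a j).
Proof.
move=> aM; rewrite (_ : (fun _ => _) = series a); last first.
  by apply/funext => k; rewrite /series/= big_mkord.
apply: normed_cvg; apply: nondecreasing_is_cvgn.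
  by apply: nondecreasing_series => n _ _; exact: normr_ge0.
by exists M => _ [k _ <-]; have := aM k; rewrite -(big_mkord xpredT (fun j => `|a j|)).
Qed.

(* The dual of [X] is complete: a geometric series of functionals converges
   pointwise to its sum. *)
Lemma weak_cvg_bounded {R : realType} {V : lmodType R} (X : set V) (nX : V -> R)
    (f_ : nat -> V) (f : V) :
  (forall n, X (f_ n)) -> weak_cvg X nX f_ f ->
  exists C, forall n phi,
    (forall a g h, X g -> X h -> phi (a *: g + h) = a * phi g + phi h) ->
    (forall g, X g -> `|phi g| <= nX g) -> `|phi (f_ n)| <= C.
Proof.
move=> Xf cf.
(* This is the unit ball of the dual. Points and functionals exchange roles: each [f_ n] acts on the
   ball by evaluation. *)
pose B : set (V -> R) := [set phi |
  (forall a g h, X g -> X h -> phi (a *: g + h) = a * phi g + phi h) /\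
  forall g, X g -> `|phi g| <= nX g].
have [|phi b Bphi|C HC] := @uniform_boundedness R _ B (fun n phi => phi (f_ n)).
- by move=> n; exists (nX (f_ n)) => phi [_]; apply.
- pose S g k := \sum_(j < k) (-1) ^+ b j * 4^-1 ^+ j * phi j g.
  have Sle g k : X g -> \sum_(j < k) `|(-1) ^+ b j * 4^-1 ^+ j * phi j g| <= 4 / 3 * nX g.
    move=> Xg; apply: (@signed_geometric_sum_le _ (fun j => phi j g)) => j.
    exact: (Bphi j).2.
  have cS g : X g -> cvgn (S g).
    move=> Xg; apply: (@abs_summable_cvgn _ (fun j => (-1) ^+ b j * 4^-1 ^+ j * phi j g)
      (4 / 3 * nX g)) => k.
    exact: Sle.
  pose Phi g := limn (S g).
  have dPhi : dual X nX Phi.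
    split => [a g h Xg Xh|].
      rewrite /Phi (_ : S (a *: g + h) = (fun k => a * S g k + S h k)).
        apply: cvg_lim => //; apply: cvgD; last exact: cS.
        by apply: cvgMr; exact: cS.
      apply/funext => k; rewrite /S mulr_sumr -big_split/=.
      by apply: eq_bigr => j _; rewrite (Bphi j).1// mulrDr mulrCA.
    exists (4 / 3) => g Xg; rewrite -lim_norm; last exact: cS.
    apply: limr_le; first by apply: is_cvg_norm; exact: cS.
    by apply: nearW => k; apply: le_trans (ler_norm_sum _ _ _) _; exact: Sle.
  exists Phi; split; last by move=> n; apply: cS.
  have : cvgn (fun n => Phi (f_ n)) by apply/cvg_ex; exists (Phi f); exact: cf.
  move=> /cvg_seq_bounded[M [_ /(_ (M + 1))]]; rewrite ltrDl ltr01 => /(_ isT) HM.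
  by exists (M + 1) => n; exact: HM.
- by exists C => n phli lin le; apply: HC.
Qed.

(** * Series in L^1 and boundedness of weak-star convergent sequences *)

Section L1_series.
Context {d} {T : measurableType d} {R : realType}.
Variables (mu : {measure set T -> \bar R}) (D : set T).
Hypothesis mD : measurable D.

(** This is the completeness of L^1, phrased through pairings as the gliding hump requires, with one
    sum [G] serving all bounded [g]. The series [F] of absolute values is integrable by monotone
    convergence, hence finite almost everywhere; there the series converges absolutely, and a
    multiple of [F] dominates the partial sums against [g]. *)
Lemma L1_series (h : nat -> T -> R) M :
  (forall k, mu.-integrable D (EFin \o h k)) ->
  (forall n, \sum_(k < n) \int[mu]_(x in D) `|h k x| <= M) ->
  exists2 G : T -> R, mu.-integrable D (EFin \o G) &
    forall g, Lfun_on mu D +oo g ->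
      (\sum_(k < n) pairing mu D g (h k)) @[n --> \oo] --> pairing mu D g G.
Proof.
move=> ih hM.
have mh k : measurable_fun D (h k) by exact/measurable_EFinP/(measurable_int mu).
pose F x := (\sum_(k <oo) `|h k x|%:E)%E.
have mF : measurable_fun D F.
  apply: ge0_emeasurable_sum => [k x _ _|k _]; first by rewrite lee_fin.
  by apply/measurable_EFinP; apply: measurableT_comp.
have F0 x : (0 <= F x)%E by apply: nneseries_ge0 => k _ _; rewrite lee_fin.
have iF : mu.-integrable D F.
  apply/integrableP; split => //; under eq_integral do rewrite gee0_abs//.
  rewrite integral_nneseries//; last first.
    by move=> k; apply/measurable_EFinP; apply: measurableT_comp.
  apply: (@le_lt_trans _ _ M%:E); last exact: ltry.
  apply: lime_le; first by apply: is_cvg_nneseries => k _ _; apply: integral_ge0.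
  apply: nearW => n; rewrite big_mkord.
  apply: (@le_trans _ _ (\sum_(k < n) \int[mu]_(x in D) `|h k x|)%R%:E); last first.
    by rewrite lee_fin.
  rewrite -sumEFin; apply: lee_sum => k _; rewrite /Rintegral fineK//;
    apply: integrable_fin_num => //;
    exact: (integrable_norm (ih k)).
pose S n x := \sum_(k < n) h k x.
have mS n : measurable_fun D (S n).
  by apply: measurable_sum => k.
(* The upper limit is measurable without modification on a null set, and it is the sum wherever the
   series converges. *)
pose G x := fine (limn_esup (fun n => (S n x)%:E)).
have mG : measurable_fun D G.
  by apply: measurableT_comp => //; apply: measurable_fun_limn_esup => n; exact/measurable_EFinP.
have SG : {ae mu, forall x, D x -> F x \is a fin_num -> S n x @[n --> \oo] --> G x}.
  apply: aeW => x Dx Ffin.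
  have cS : cvgn (S ^~ x).
    apply: (@abs_summable_cvgn _ (h ^~ x) (fine (F x))) => n.
    rewrite -lee_fin fineK// -sumEFin -(big_mkord xpredT (fun k => `|h k x|%:E)).
    by apply: nneseries_lim_ge => k _ _; rewrite lee_fin.
  have cE : (S n x)%:E @[n --> \oo] --> (limn (S ^~ x))%:E.
    by apply: cvg_EFin; [exact: nearW|exact: cS].
  rewrite /G is_cvg_limn_esupE; last by apply/cvg_ex; eexists; exact: cE.
  by rewrite (cvg_lim _ cE).
have SF n x : D x -> F x \is a fin_num -> (`|S n x|%:E <= F x)%E.
  move=> Dx Ffin; apply: (@le_trans _ _ (\sum_(k < n) `|h k x|%:E)%E).
    by rewrite sumEFin lee_fin ler_norm_sum.
  rewrite -(big_mkord xpredT (fun k => `|h k x|%:E)).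
  by apply: nneseries_lim_ge => k _ _; rewrite lee_fin.
have Ffin := integrable_ae mD iF.
have cvgS g : Lfun_on mu D +oo g -> mu.-integrable D (EFin \o (g \* G)) /\
    (\sum_(k < n) pairing mu D g (h k)) @[n --> \oo] --> pairing mu D g G.
  move=> goo; have mg := Lfun_on_measurable mD goo.
  have [K K0 gK] := Lfun_on_ae_bounded mD goo.
  have ig k := (integrable_bounded_mul mD mg (ih k) gK).1.
  have [|||||igG _] := @dominated_convergence _ _ _ mu D mD
    (fun n x => (g x * S n x)%:E) (fun x => (g x * G x)%:E) (fun x => (K%:E * F x)%E).
  - by move=> n; apply/measurable_EFinP; exact: measurable_funM.
  - by apply/measurable_EFinP; exact: measurable_funM.
  - apply: filterS2 SG Ffin => x SGx Fx Dx.
    by apply: cvg_EFin; [exact: nearW|apply: cvgMr; apply: SGx => //; exact: Fx].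
  - exact: integrableZl.
  - apply: filterS2 gK Ffin => x gx Fx n Dx.
    rewrite abse_EFin normrM EFinM; apply: lee_pmul => //; rewrite ?lee_fin//.
      exact: gx.
    by apply: SF => //; exact: Fx.
  move=> cv; split => //.
  have -> : (fun n => \sum_(k < n) pairing mu D g (h k)) =
      (fun n => fine (\int[mu]_(x in D) (g x * S n x)%:E)%E).
    apply/funext => n; rewrite -/(Rintegral mu D (fun x => g x * S n x)).
    elim: n => [|n ihn].
      rewrite big_ord0 /S /Rintegral; under eq_integral do rewrite big_ord0 mulr0.
      by rewrite integral0.
    rewrite big_ord_recr/= ihn /S.
    under [RHS]eq_Rintegral do rewrite big_ord_recr/= mulrDr.
    rewrite RintegralD//; last exact: (ig n).
    rewrite (_ : _ \o _ = (fun x => (\sum_(k < n) (g x * h k x)%:E)%E)).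
      by apply: integrable_sum => // k _; exact: (ig k).
    by apply/funext => x /=; rewrite mulr_sumr sumEFin.
  apply: fine_cvg; rewrite /pairing /Rintegral fineK//.
  exact: integrable_fin_num.
exists G; last by move=> g /cvgS[].
have [|+ _] := cvgS (cst 1).
  apply: (@ae_bounded_Lfun_on _ _ _ mu _ mD _ 1) => //.
  by apply: aeW => x _; rewrite normr1.
by apply: eq_integrable => // x _ /=; rewrite mul1r.
Qed.

(** Weak-star convergence is tested on L^1, so the gliding hump runs in the unit ball of L^1 and
    [L1_series] sums the humps. The general [h] follows by scaling. *)
Lemma weak_star_cvg_bounded (g_ : nat -> T -> R) g :
  (forall n, Lfun_on mu D +oo (g_ n)) -> weak_star_cvg mu D g_ g ->
  exists C, forall n h, mu.-integrable D (EFin \o h) ->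
    `|pairing mu D (g_ n) h| <= C * \int[mu]_(x in D) `|h x|.
Proof.
move=> goo cg.
pose B : set (T -> R) := [set h : T -> R | mu.-integrable D (EFin \o h) /\
  \int[mu]_(x in D) `|h x| <= 1].
have bound n : exists2 K, 0 <= K & forall h, mu.-integrable D (EFin \o h) ->
    `|pairing mu D (g_ n) h| <= K * \int[mu]_(x in D) `|h x|.
  have [K K0 gK] := Lfun_on_ae_bounded mD (goo n); exists K => // h ih.
  have [igh le] := integrable_bounded_mul mD (Lfun_on_measurable mD (goo n)) ih gK.
  rewrite ger0_norm// in le; apply: le_trans le; exact: le_normr_Rintegral.
have [|h b Bh|C HC] := @uniform_boundedness R _ B (fun n h => pairing mu D (g_ n) h).
- move=> n; have [K K0 HK] := bound n; exists K => h [ih h1].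
  by apply: le_trans (HK _ ih) _; rewrite -[leRHS]mulr1 ler_wpM2l.
- have ih k := (Bh k).1.
  pose a k := (-1) ^+ b k * 4^-1 ^+ k : R.
  have iah k : mu.-integrable D (EFin \o (a k \*o h k)).
    exact: (@integrableZl _ _ _ mu D mD (a k) _ (ih k)).
  have [|G iG cG] := @L1_series (fun k => a k \*o h k) (4 / 3 * 1) iah.
    move=> n; have := @signed_geometric_sum_le _ (fun k => \int[mu]_(x in D) `|h k x|) b 1 n.
    move=> H; apply: le_trans (H _); last first.
      by move=> j; rewrite ger0_norm ?Rintegral_ge0//; exact: (Bh j).2.
    apply: ler_sum => k _; rewrite le_eqVlt; apply/orP; left; apply/eqP.
    rewrite normrM [X in _ * X]ger0_norm ?Rintegral_ge0// -RintegralZl//; last first.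
      exact: (integrable_norm (ih k)).
    by apply: eq_Rintegral => x _; rewrite -normrM.
  exists G; split.
    have : cvgn (fun n => pairing mu D (g_ n) G).
      by apply/cvg_ex; eexists; apply: cg; exact/Lfun_on1P.
    move=> /cvg_seq_bounded[M [_ /(_ (M + 1))]]; rewrite ltrDl ltr01 => /(_ isT) HM.
    by exists (M + 1) => n; exact: HM.
  move=> n; have := cG _ (goo n).
  apply: cvg_trans; apply: near_eq_cvg; apply: nearW => k.
  apply: eq_bigr => j _; rewrite -/(a j) /pairing -RintegralZl//.
    by apply: eq_Rintegral => x _; rewrite /= mulrCA.
  have [K _ gK] := Lfun_on_ae_bounded mD (goo n).
  exact: (integrable_bounded_mul mD (Lfun_on_measurable mD (goo n)) (ih j) gK).1.
exists C => n h ih; have [K K0 HK] := bound n.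
set I := \int[mu]_(x in D) `|h x|.
have : 0 <= I by exact: Rintegral_ge0.
(* Normalising divides by [I]; when [I] is 0, the bound for this single [n] already makes the
   pairing vanish. *)
rewrite le_eqVlt => /predU1P[I0|I0].
  by have := HK _ ih; rewrite -/I -I0 !mulr0.
have := HC n (I^-1 \*o h) _.
have -> : pairing mu D (g_ n) (I^-1 \*o h) = I^-1 * pairing mu D (g_ n) h.
  rewrite /pairing -RintegralZl//.
    by apply: eq_Rintegral => x _; rewrite /= mulrCA.
  have [K' _ gK'] := Lfun_on_ae_bounded mD (goo n).
  exact: (integrable_bounded_mul mD (Lfun_on_measurable mD (goo n)) ih gK').1.
rewrite normrM gtr0_norm ?invr_gt0// mulrC ler_pdivrMr//; apply; split.
  exact: (@integrableZl _ _ _ mu D mD I^-1 _ ih).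
rewrite le_eqVlt; apply/orP; left; apply/eqP.
transitivity (I^-1 * I); last by rewrite mulVf// gt_eqF.
rewrite /I -RintegralZl//; last exact: (integrable_norm ih).
by apply: eq_Rintegral => x _; rewrite /= normrM gtr0_norm ?invr_gt0.
Qed.

End L1_series.

(** * From weak to strong convergence through a compact embedding *)

Lemma cvg_increasing_nat (k : nat -> nat) : {homo k : m n / (m < n)%N} ->
  k n @[n --> \oo] --> \oo.
Proof.
move=> kS; have kn n : (n <= k n)%N.
  by elim: n => // n ih; exact: leq_ltn_trans ih (kS _ _ (ltnSn n)).
apply/cvgnyPge => A; exists A => // n /= An; exact: leq_trans An (kn n).
Qed.

Lemma not_cvg0_subseq {R : realType} (a : nat -> R) : (forall n, 0 <= a n) ->
  ~ (a n @[n --> \oo] --> (0 : R)) ->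
  exists (j : nat -> nat) (e : R),
    [/\ {homo j : m n / (m < n)%N}, 0 < e & forall n, e <= a (j n)].
Proof.
move=> a0 /cvgr0Pnorm_lt/existsNP[e /not_implyP[e0 ne]].
have next n : exists m, (n <= m)%N /\ e <= a m.
  apply: contrapT => /forallNP h; apply: ne; exists n => // m /= nm.
  rewrite ger0_norm// ltNge; apply/negP => em.
  by apply: (h m); split.
have [c cP] := choice next.
pose j := fix j n := if n is m.+1 then c (j m).+1 else c 0%N.
exists j, e; split => //; last by case=> [|n]; exact: (cP _).2.
by apply: homo_ltn => // [m n p|n]; [exact: ltn_trans|exact: (cP _).1].
Qed.

Section compact_embedding.
Context {R : realType} {V : lmodType R}.
Variables (X Y : set V) (nX nY : V -> R).
Hypothesis YB : forall f g, Y f -> Y g -> Y (f - g).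
Hypothesis nY0 : forall f, 0 <= nY f.
Hypothesis nYD : forall f g, Y f -> Y g -> nY (f + g) <= nY f + nY g.
(** A substitute for the Hahn-Banach theorem: the functional may depend on [g] and need only detect
    whether the seminorm of this one [g] is zero. *)
Hypothesis separating : forall g, Y g ->
  exists2 psi, dual Y nY psi & (psi g = 0 -> nY g = 0).

Lemma dual_subB (psi : V -> R) f g : dual Y nY psi -> Y f -> Y g ->
  psi (f - g) = psi f - psi g.
Proof.
by move=> [lin _] Yf Yg; rewrite addrC -scaleN1r lin// mulN1r addrC.
Qed.

(** Otherwise a subsequence stays at distance [e] from [f], and compactness gives a further one
    converging strongly to some [g]. A functional bounded on [Y] is bounded on [X] by the continuous
    embedding, so weak convergence forces it to agree on [f] and [g]; one separating [g - f] then
    shows that the distance from [f] tends to 0. *)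
Lemma compact_embedding_strong (f_ : nat -> V) f :
  compactly_embedded X nX Y nY -> (forall n, X (f_ n)) -> X f ->
  (exists M, forall n, nX (f_ n) <= M) -> weak_cvg X nX f_ f ->
  nY (f_ n - f) @[n --> \oo] --> (0 : R).
Proof.
move=> [XY [C XYC] comp] Xf_ Xf [M f_M] cf; apply: contrapT => /not_cvg0_subseq[//|].
move=> j [e [jS e0 ej]].
have [||k [g [kS Yg cg]]] := comp (f_ \o j).
- by move=> n; exact: Xf_.
- by exists M => n; exact: f_M.
have Yf_ n : Y (f_ n) by exact: XY.
have Yf : Y f by exact: XY.
have [psi dpsi psi0] := separating (YB Yg Yf).
have [lin [K psiK]] := dpsi.
have dX : dual X nX psi.
  split; first by move=> a x y Xx Xy; apply: lin; exact: XY.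
  exists (`|K| * C) => x Xx; apply: le_trans (psiK _ (XY _ Xx)) _.
  rewrite -mulrA; apply: (@le_trans _ _ (`|K| * nY x)); first by rewrite ler_wpM2r ?ler_norm.
  by rewrite ler_wpM2l// XYC.
have jk : (j \o k) n @[n --> \oo] --> \oo.
  by apply: cvg_increasing_nat => m n mn; apply: jS; exact: kS.
have c1 : psi (f_ (j (k n))) @[n --> \oo] --> psi f.
  apply: (@cvg_comp _ _ _ (j \o k) (fun n => psi (f_ n)) _ _ _ jk); exact: cf.
have c2 : psi (f_ (j (k n))) @[n --> \oo] --> psi g.
  apply/cvgrPdist_le => /= r r0.
  have : `|K| * nY (f_ (j (k n)) - g) @[n --> \oo] --> `|K| * 0.
    exact: cvgMr.
  rewrite mulr0 => /cvgr0Pnorm_le/(_ _ r0); apply: filterS => n /=.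
  rewrite ger0_norm ?mulr_ge0//; apply: le_trans.
  rewrite distrC -dual_subB//; apply: le_trans (psiK _ _) _; first exact: YB.
  by rewrite ler_wpM2r ?ler_norm.
have : psi g = psi f by rewrite -(cvg_lim _ c2)// -(cvg_lim _ c1).
move=> /eqP; rewrite -subr_eq0 -dual_subB// => /eqP/psi0 gf0.
have : e <= 0.
  rewrite -(cvg_lim _ cg)//; apply: limr_ge; first by apply/cvg_ex; exists 0; exact: cg.
  apply: nearW => n; apply: le_trans (ej (k n)) _.
  rewrite (_ : f_ _ - f = (f_ (j (k n)) - g) + (g - f)); last by rewrite addrA subrK.
  by apply: le_trans (nYD _ _) _; [exact: YB|exact: YB|rewrite gf0 addr0].
by rewrite leNgt e0.
Qed.

End compact_embedding.

(** * Separating functionals on L^q, and L^1 convergence under an unbounded weight *)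

Section strong_convergence.
Context {d} {T : measurableType d} {R : realType}.
Variables (mu : {measure set T -> \bar R}) (D : set T).
Hypothesis mD : measurable D.

Lemma ae_eq0_Lnorm_on (p : \bar R) (g : T -> R) : (1 <= p)%E ->
  measurable_fun D g -> {ae mu, forall x, D x -> g x = 0} ->
  Lnorm_on mu D p g = 0.
Proof.
move=> p1 mg g0; have gD0 : {ae mu, forall x, (g \_ D) x = 0}.
  by apply: filterS g0 => x gx; rewrite /patch; case: ifPn => // /set_mem/gx.
rewrite /Lnorm_on unlock /Lnorm; case: p p1 => [p| |]// p1.
  have p0 : p != 0 by rewrite gt_eqF// (lt_le_trans ltr01).
  rewrite (ae_eq_integral (cst 0%E))//.
  - by rewrite integral0 poweR0r// invr_neq0.
  - apply: (measurableT_comp (measurable_poweR _)); apply: measurableT_comp => //.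
    exact/measurable_EFinP/(measurable_restrictT _ mD).1.
  - by apply: filterS gD0 => x /= -> _; rewrite normr0 powR0.
case: ifPn => // mu0; rewrite (ess_sup_ae_cst 0%E)//.
by apply: filterS gD0 => x /= ->; rewrite normr0.
Qed.

(* The truncation of [g] to [-1, 1] is a bounded test function pairing
   nonnegatively with [g]. *)
Lemma Lfun_on_separating (p q : \bar R) (g : T -> R) :
  (mu D < +oo)%E -> (1 <= p)%E -> (1 <= q)%E -> (p^-1 + q^-1 = 1)%E ->
  Lfun_on mu D q g ->
  exists2 psi, dual (Lfun_on mu D q) (Lnorm_on mu D q) psi &
    (psi g = 0 -> Lnorm_on mu D q g = 0).
Proof.
move=> Dfin p1 q1 pq qg; have mg := Lfun_on_measurable mD qg.
pose t x := Num.max (-1) (Num.min 1 (g x)).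
have mt : measurable_fun D t.
  by apply: measurable_maxr => //; exact: measurable_minr.
have t1 x : D x -> `|t x| <= 1.
  move=> _; rewrite ler_norml /t le_max lexx/= ge_max ge_min lexx/=.
  by rewrite (le_trans _ ler01)// lerN10.
have pt : Lfun_on mu D p t by exact: Lfun_on_bounded_finite t1.
have ift f : Lfun_on mu D q f -> mu.-integrable D (EFin \o (f \* t)).
  by move=> qf; apply: (hoelder_on mD q1 p1 _ qf pt).1; rewrite addeC.
exists (fun f => pairing mu D f t).
  split; first by move=> a x y Xx Xy; apply: pairingZD => //; exact: ift.
  exists (Lnorm_on mu D p t) => f qf; rewrite mulrC.
  by apply: (pairing_le mD q1 p1) => //; rewrite addeC.
move=> gt0; apply: ae_eq0_Lnorm_on => //.
have gt x : 0 <= g x * t x.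
  rewrite /t; have [g0|g0] := leP 0 (g x).
    by rewrite mulr_ge0// le_max le_min ler01 g0 orbT.
  rewrite mulr_le0 ?(ltW g0)// ge_max lerN10 /= ge_min (ltW g0) orbT//.
(* As [g * t] is nonnegative, its zero integral makes it vanish almost everywhere, and [t] is zero
   only where [g] is. *)
have : (\int[mu]_(x in D) `|(g x * t x)%:E| = 0)%E.
  transitivity (\int[mu]_(x in D) (g x * t x)%:E)%E.
    by apply: eq_integral => x _; rewrite gee0_abs ?lee_fin.
  by rewrite -[LHS]fineK; [congr EFin|exact: integrable_fin_num (ift _ qg)].
move=> /(ae_eq_integral_abs mu mD) => /(_ _)/[!measurable_EFinP]/(_ (measurable_funM mg mt)).
apply: filterS => x /= /[apply] -[] /eqP; rewrite mulf_eq0 => /orP[/eqP//|].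
rewrite /t; have [g1|g1] := leP 1 (g x); have [h|h] := leP (-1) _ => /eqP; lra.
Qed.

(** The cut is on [rho V] rather than on [V] because that product is the coefficient of [w_ n] in
    the integrand to be estimated. *)
Definition large_part (V rho : T -> R) (k : nat) x := if k%:R < `|rho x * V x| then V x else 0.

Lemma cauchy_schwarz_on f g : Lfun_on mu D 2%:E f -> Lfun_on mu D 2%:E g ->
  mu.-integrable D (EFin \o (f \* g)) /\
  \int[mu]_(x in D) `|f x * g x| <= Lnorm_on mu D 2%:E f * Lnorm_on mu D 2%:E g.
Proof.
apply: (hoelder_on mD); rewrite ?lee_fin ?ler1n//.
by rewrite inver pnatr_eq0/= -EFinD; congr (_%:E); lra.
Qed.

Lemma Lfun_on_large_part (V rho : T -> R) k : measurable_fun D rho ->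
  Lfun_on mu D 2%:E V -> Lfun_on mu D 2%:E (large_part V rho k).
Proof.
move=> mrho /(Lfun_on2P mu mD)[mV V2]; apply/(Lfun_on2P mu mD); split.
  apply: measurable_fun_if => //.
    by apply: measurable_fun_ltr => //; apply: measurableT_comp => //; exact: measurable_funM.
  exact: measurable_funS mV.
apply: le_lt_trans V2; apply: ge0_le_integral => //.
- by move=> x _; rewrite lee_fin sqr_ge0.
- apply/measurable_EFinP; apply: measurable_funX; apply: measurable_fun_if => //.
    by apply: measurable_fun_ltr => //; apply: measurableT_comp => //; exact: measurable_funM.
  exact: measurable_funS mV.
- by apply/measurable_EFinP; exact: measurable_funX.
- move=> x _; rewrite lee_fin /large_part; case: ifPn => // _.
  by rewrite expr0n sqr_ge0.
Qed.

(** At each point [rho V] is a finite number, so the large part vanishes there once [k] exceeds its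
    modulus; [V ^+ 2] dominates the squares. *)
Lemma Lnorm_on_large_part_cvg0 (V rho : T -> R) : measurable_fun D rho ->
  Lfun_on mu D 2%:E V ->
  Lnorm_on mu D 2%:E (large_part V rho k) @[k --> \oo] --> (0 : R).
Proof.
move=> mrho V2; have [mV Vfin] := (Lfun_on2P mu mD V).1 V2.
have iV2 : mu.-integrable D (fun x => (V x ^+ 2)%:E).
  apply/integrableP; split; first by apply/measurable_EFinP; exact: measurable_funX.
  by under eq_integral do rewrite gee0_abs ?lee_fin ?sqr_ge0//.
have mt k := Lfun_on_measurable mD (Lfun_on_large_part k mrho V2).
have [|||||_ _] := @dominated_convergence _ _ _ mu D mD
    (fun k x => (large_part V rho k x ^+ 2)%:E) (cst 0%E) (fun x => (V x ^+ 2)%:E) => //.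
- by move=> k; apply/measurable_EFinP; exact: measurable_funX.
- apply: aeW => x Dx; apply: cvg_near_cst; exists (Num.truncn `|rho x * V x|).+1 => // k /= hk.
  rewrite /large_part ifF ?expr0n//; apply/negbTE; rewrite -leNgt.
  by apply: le_trans (ltW (truncnS_gt _)) _; rewrite ler_nat.
- apply: aeW => x k Dx; rewrite lee_fin ger0_norm ?sqr_ge0// /large_part.
  by case: ifPn => // _; rewrite expr0n sqr_ge0.
rewrite integral0 => /fine_cvgP[_] c0.
have c1 : Num.sqrt (Lnorm_on mu D 2%:E (large_part V rho k) ^+ 2) @[k --> \oo] --> Num.sqrt (0 : R).
  apply: continuous_cvg; first exact: sqrt_continuous.
  by under eq_fun do rewrite (Lnorm_on2 mD (Lfun_on_large_part _ mrho V2)); exact: c0.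
rewrite sqrtr0 in c1; apply: cvg_trans c1; apply: near_eq_cvg; apply: nearW => k.
by rewrite sqrtr_sqr ger0_norm// Lnorm_on_ge0.
Qed.

(* Where [|rho V| <= k] the integral is at most k times the L^1 norm of [w_ n];
   the rest is handled by the Cauchy-Schwarz inequality. *)
Lemma weighted_L1_cvg0 (w_ : nat -> T -> R) (V rho : T -> R) M :
  measurable_fun D rho -> Lfun_on mu D 2%:E V ->
  (forall n, mu.-integrable D (EFin \o w_ n)) ->
  (forall n, Lfun_on mu D 2%:E (rho \* w_ n)) ->
  (forall n, Lnorm_on mu D 2%:E (rho \* w_ n) <= M) ->
  (\int[mu]_(x in D) `|w_ n x|) @[n --> \oo] --> (0 : R) ->
  (\int[mu]_(x in D) `|rho x * w_ n x * V x|) @[n --> \oo] --> (0 : R).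
Proof.
move=> mrho V2 iw w2 wM w0.
have M0 : 0 <= M by apply: le_trans (wM 0%N); exact: Lnorm_on_ge0.
have bound k n : \int[mu]_(x in D) `|rho x * w_ n x * V x| <=
    k%:R * (\int[mu]_(x in D) `|w_ n x|) + M * Lnorm_on mu D 2%:E (large_part V rho k).
  have [irwV _] := cauchy_schwarz_on (w2 n) V2.
  have [irwt le] := cauchy_schwarz_on (w2 n) (Lfun_on_large_part k mrho V2).
  have ikw : mu.-integrable D (EFin \o (fun x => k%:R * `|w_ n x|)).
    exact: (@integrableZl _ _ _ mu D mD k%:R _ (integrable_norm (iw n))).
  apply: (@le_trans _ _ (\int[mu]_(x in D) (k%:R * `|w_ n x| +
      `|(rho \* w_ n) x * large_part V rho k x|))); last first.
    rewrite RintegralD//; last exact: (integrable_norm irwt).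
    rewrite RintegralZl//; last exact: (integrable_norm (iw n)).
    by rewrite lerD2l; apply: le_trans le _; rewrite ler_wpM2r ?Lnorm_on_ge0.
  apply: le_Rintegral => //; first exact: (integrable_norm irwV).
    exact: (integrableD mD ikw (integrable_norm irwt)).
  move=> x Dx /=; rewrite /large_part; case: ltP => [_|rV].
    by rewrite lerDr mulr_ge0.
  by rewrite mulr0 normr0 addr0 mulrAC normrM ler_wpM2r.
apply/cvgr0Pnorm_le => e e0.
(* The level [k] is fixed first, uniformly in [n] thanks to [M]; only then does [n] tend to
   infinity. *)
have : M * Lnorm_on mu D 2%:E (large_part V rho k) @[k --> \oo] --> M * 0.
  by apply: cvgMr; exact: Lnorm_on_large_part_cvg0.
have e20 : 0 < e / 2 by rewrite divr_gt0.
rewrite mulr0 => /cvgr0Pnorm_le/(_ _ e20)[k _ /(_ k (leqnn k))/= hk].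
have : k%:R * (\int[mu]_(x in D) `|w_ n x|) @[n --> \oo] --> k%:R * (0 : R).
  exact: cvgMr.
rewrite mulr0 => /cvgr0Pnorm_le/(_ _ e20); apply: filterS => n hn.
rewrite ger0_norm ?Rintegral_ge0//; apply: le_trans (bound k n) _.
rewrite (splitr e); apply: lerD; first exact: le_trans (ler_norm _) hn.
exact: le_trans (ler_norm _) hk.
Qed.

End strong_convergence.

(** * Measurability of open sets and finite volume of bounded sets in R^N *)

Section lebesgue_rV_theory.
Context {R : realType} {N : nat}.

Lemma measurable_rV_box (A : 'I_N -> set (measurableTypeR R)) :
  (forall i, measurable (A i)) ->
  measurable [set x : 'rV[R]_N | forall i, A i (x 0 i)].
Proof.
move=> mA; rewrite (_ : mkset _ =
    \big[setI/setT]_(i < N) ((fun x : 'rV[R]_N => x 0 i) @^-1` A i)).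
  apply: bigsetI_measurable => i _.
  by rewrite -[X in measurable X]setTI; exact: measurable_rV_coord.
apply/seteqP; split => x /=; rewrite -bigcap_seq /= => h i; first by move=> _; exact: h.
by apply: h => /=; rewrite mem_index_enum.
Qed.

(** The sigma-algebra comes from the coordinates, and balls of the maximum norm are boxes; hence an
    open set is a countable union of rational boxes. *)
Lemma open_measurable_rV (U : set 'rV[R]_N) : open U -> measurable U.
Proof.
move=> oU.
pose B (c : 'rV[rat]_N * nat) := [set x : 'rV[R]_N |
  forall i, `]ratr (c.1 0 i) - c.2.+1%:R^-1, ratr (c.1 0 i) + c.2.+1%:R^-1[%classic (x 0 i)].
have mB c : measurable (B c).
  by apply: (measurable_rV_box (A := fun i => _)) => i; exact: measurable_itv.
have -> : U = \bigcup_c (if `[< B c `<=` U >] then B c else set0).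
  apply/seteqP; split => [x Ux|x [c _]]; last by case: ifPn => // /asboolP; apply.
  have /nbhs_ballP[e /= e0 xeU] : nbhs x U by exact: open_nbhs_nbhs.
  (* This gives [dl < e / 2]: a rational centre within [dl] of [x] has its box of half-width [dl]
     inside the ball of radius [e] around [x]. *)
  pose n := Num.truncn (2 / e).
  pose dl : R := n.+1%:R^-1.
  have dl0 : 0 < dl by rewrite invr_gt0.
  have dle : dl + dl < e.
    have : dl < e / 2 by rewrite invf_plt ?posrE ?divr_gt0// invf_div truncnS_gt.
    by move=> h; rewrite (splitr e) ltrD.
  have /choice[q qx] : forall i, exists q : rat, x 0 i - dl < ratr q < x 0 i + dl.
    move=> i; have [|q] := @rat_in_itvoo R (x 0 i - dl) (x 0 i + dl); first lra.
    by rewrite in_itv/=; exists q.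
  exists (\row_i q i, n) => //; rewrite ifT.
    by move=> i /=; rewrite mxE in_itv/= -/dl; have /andP[? ?] := qx i; apply/andP; split; lra.
  apply/asboolP => y By; apply: xeU; split => // i j; rewrite ord1.
  have := By j; rewrite /= mxE in_itv/= -/dl => /andP[? ?].
  have /andP[? ?] := qx j.
  by rewrite /ball/= ltr_norml; apply/andP; split; lra.
apply: countable_bigcupT_measurable => // c.
by case: ifPn => // _; exact: measurable0.
Qed.

Lemma bounded_lebesgue_rV_lty (U : set 'rV[R]_N) : bounded_set U ->
  measurable U -> (lebesgue_rV N U < +oo)%E.
Proof.
move=> [M [_ /(_ (M + 1))]]; rewrite ltrDl ltr01 => /(_ isT) UM mU.
pose K := M + 1.
have mI (i : 'I_N) : measurable (`[- K, K]%classic : set (measurableTypeR R)).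
  exact: measurable_itv.
apply: (@le_lt_trans _ _ (lebesgue_rV N [set x | forall i : 'I_N, `[- K, K]%classic (x 0 i)])).
  apply: le_measure; rewrite ?inE//; first exact: (measurable_rV_box mI).
  move=> x Ux i /=; rewrite in_itv/= -ler_norml.
  apply: le_trans (UM _ Ux); rewrite [leRHS]/Num.norm/= mx_normrE.
  by apply/bigmax_geP; right => /=; exists (0, i).
have := lebesgue_rV_box mI; rewrite lebesgue_measure_itv/= => ->.
rewrite ltey_eq; apply/orP; left; elim/big_ind : _ => // [a b|i _]; first exact: fin_numM.
by case: ifPn.
Qed.

End lebesgue_rV_theory.

(** * Tonelli for functions of a single variable on a product set *)

Section product_integral.
Context {d1 d2} {T1 : measurableType d1} {T2 : measurableType d2} {R : realType}.
Variables (m1 : {sigma_finite_measure set T1 -> \bar R}).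
Variables (m2 : {sigma_finite_measure set T2 -> \bar R}).
Variables (D1 : set T1) (D2 : set T2).
Hypotheses (mD1 : measurable D1) (mD2 : measurable D2).

Lemma restrict_fst (f : T1 -> R) :
  (fun z : T1 * T2 => `|f z.1|%:E) \_ (D1 `*` D2) =
  (fun z => (`|(f \_ D1) z.1| * \1_D2 z.2)%:E).
Proof.
apply/funext => -[x y]; rewrite /patch/= indicE in_setX/=.
case: (x \in D1) => /=; last by rewrite normr0 mul0r.
by case: (y \in D2); rewrite ?mulr1 ?mulr0.
Qed.

Lemma restrict_snd (f : T2 -> R) :
  (fun z : T1 * T2 => `|f z.2|%:E) \_ (D1 `*` D2) =
  (fun z => (\1_D1 z.1 * `|(f \_ D2) z.2|)%:E).
Proof.
apply/funext => -[x y]; rewrite /patch/= indicE in_setX/= andbC.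
case: (y \in D2) => /=; last by rewrite normr0 mulr0.
by case: (x \in D1); rewrite ?mul1r ?mul0r.
Qed.

Lemma integral_abs_fst (f : T1 -> R) : measurable_fun D1 f ->
  (\int[m1 \x m2]_(z in D1 `*` D2) `|f z.1|%:E =
   m2 D2 * \int[m1]_(x in D1) `|f x|%:E)%E.
Proof.
move=> /(measurable_restrictT _ mD1) mf.
rewrite integral_mkcond restrict_fst fubini_tonelli1; first last.
- by move=> z; rewrite lee_fin mulr_ge0.
- apply/measurable_EFinP; apply: measurable_funM.
    by do 2!apply: measurableT_comp => //.
  by apply: measurableT_comp => //; exact: measurable_indic.
rewrite [in RHS]integral_mkcond.
transitivity (\int[m1]_x (m2 D2 * `|(f \_ D1) x|%:E))%E.
  apply: eq_integral => x _; rewrite /fubini_F/=.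
  under eq_integral do rewrite EFinM.
  by rewrite ge0_integralZl//; [rewrite integral_indic// setIT muleC|
    apply/measurable_EFinP; exact: measurable_indic].
rewrite ge0_integralZl//; last by apply/measurable_EFinP; exact: measurableT_comp.
by congr mule; apply: eq_integral => x _; rewrite /patch; case: ifPn => //; rewrite normr0.
Qed.

Lemma integral_abs_snd (f : T2 -> R) : measurable_fun D2 f ->
  (\int[m1 \x m2]_(z in D1 `*` D2) `|f z.2|%:E =
   m1 D1 * \int[m2]_(x in D2) `|f x|%:E)%E.
Proof.
move=> /(measurable_restrictT _ mD2) mf.
rewrite integral_mkcond restrict_snd fubini_tonelli2; first last.
- by move=> z; rewrite lee_fin mulr_ge0.
- apply/measurable_EFinP; apply: measurable_funM; last first.
    by do 2!apply: measurableT_comp => //.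
  by apply: measurableT_comp => //; exact: measurable_indic.
rewrite [in RHS]integral_mkcond.
transitivity (\int[m2]_x (m1 D1 * `|(f \_ D2) x|%:E))%E.
  apply: eq_integral => x _; rewrite /fubini_G/=.
  under eq_integral do rewrite EFinM.
  by rewrite ge0_integralZr//; [rewrite integral_indic// setIT|
    apply/measurable_EFinP; exact: measurable_indic].
rewrite ge0_integralZl//; last by apply/measurable_EFinP; exact: measurableT_comp.
by congr mule; apply: eq_integral => x _; rewrite /patch; case: ifPn => //; rewrite normr0.
Qed.

End product_integral.

(** * H^s as a pair of L^2 conditions, its inner product, and bounds on increments *)

Section fractional_Sobolev_theory.
Context {R : realType}.
Variables (N : nat) (Omega : set 'rV[R]_N) (s : R).
Hypothesis mO : measurable Omega.
Implicit Types (u v w : 'rV[R]_N -> R).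
Local Notation mu := (lebesgue_rV N : {measure set 'rV[R]_N -> \bar R}).
Local Notation mu2 := (@lebesgue_rV2 R N).
Local Notation O2 := (Omega `*` Omega).

(* Square root of the Gagliardo kernel; on the diagonal both vanish. *)
Definition sqrt_kernel (z : 'rV[R]_N * 'rV[R]_N) : R :=
  euclidean_norm (z.1 - z.2) `^ (- ((N%:R + 2 * s) / 2)).

Definition increment u (z : 'rV[R]_N * 'rV[R]_N) : R := u z.1 - u z.2.

Definition gagliardo u := sqrt_kernel \* increment u.

Lemma Hs_integrandE gamma u v z :
  Hs_integrand s gamma u v z = gamma z * (gagliardo u z * gagliardo v z).
Proof.
rewrite /Hs_integrand /gagliardo/= /increment -powRN.
have -> : euclidean_norm (z.1 - z.2) `^ (- (N%:R + 2 * s)) = sqrt_kernel z * sqrt_kernel z.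
  rewrite -expr2 -powR_mulrn ?powR_ge0// /sqrt_kernel -powRrM; congr (_ `^ _).
  by field.
ring.
Qed.

Lemma measurable_sqrt_kernel : measurable_fun setT sqrt_kernel.
Proof.
apply: (measurableT_comp (measurable_powR _)).
have ms : measurable_fun setT (@Num.sqrt R).
  by apply: continuous_measurable_fun; exact: sqrt_continuous.
rewrite /euclidean_norm; apply: (measurableT_comp ms).
apply: measurable_sum => i; apply: measurable_funX.
under eq_fun do rewrite !mxE.
apply: measurable_funB.
  exact: (measurableT_comp (measurable_rV_coord i) measurable_fst).
exact: (measurableT_comp (measurable_rV_coord i) measurable_snd).
Qed.

Lemma measurable_O2 : measurable O2.
Proof. exact: measurableX. Qed.

Lemma measurable_increment u : measurable_fun Omega u ->
  measurable_fun O2 (increment u).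
Proof.
move=> mfu; apply: measurable_funB.
  apply: (measurable_comp mO) => //; first by move=> _ [z [? ?] <-].
  exact: measurable_funTS.
apply: (measurable_comp mO) => //; first by move=> _ [z [? ?] <-].
exact: measurable_funTS.
Qed.

(** Since [gagliardo] is linear, this transfers linear structure and the Cauchy-Schwarz inequality
    from L^2 to H^s. *)
Lemma HsP u : Hs Omega s u <->
  Lfun_on mu Omega 2%:E u /\ Lfun_on mu2 O2 2%:E (gagliardo u).
Proof.
have E : (\int[mu2]_(z in O2) (Hs_integrand s (cst 1%R) u u z)%:E =
    \int[mu2]_(z in O2) (gagliardo u z ^+ 2)%:E)%E.
  by apply: eq_integral => z _; rewrite Hs_integrandE mul1r expr2.
rewrite /Hs/= E; split => -[u2 Gu]; split => //.
  apply/(Lfun_on2P _ measurable_O2); split => //.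
  apply: measurable_funM; first exact: measurable_funTS measurable_sqrt_kernel.
  exact: measurable_increment (Lfun_on_measurable mO u2).
by have /(Lfun_on2P _ measurable_O2)[] := Gu.
Qed.

Lemma Hs_formE gamma u v : Hs_form Omega s gamma u v =
  pairing mu2 O2 gamma (gagliardo u \* gagliardo v).
Proof. by apply: eq_Rintegral => z _; rewrite Hs_integrandE. Qed.

Lemma gagliardoZD a u v : gagliardo (a *: u + v) = a *: gagliardo u + gagliardo v.
Proof.
apply/funext => z; rewrite /gagliardo /increment !fctE /=.
by rewrite /GRing.scale/=; ring.
Qed.

Lemma gagliardoB u v : gagliardo (u - v) = gagliardo u - gagliardo v.
Proof. by rewrite addrC -scaleN1r gagliardoZD scaleN1r addrC. Qed.

Lemma HsZD a u v : Hs Omega s u -> Hs Omega s v -> Hs Omega s (a *: u + v).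
Proof.
move=> /HsP[u2 Gu] /HsP[v2 Gv]; apply/HsP; split.
  by apply: Lfun_onZD => //; rewrite lee_fin ler1n.
rewrite gagliardoZD; by apply: Lfun_onZD => //; rewrite lee_fin ler1n.
Qed.

Lemma HsB u v : Hs Omega s u -> Hs Omega s v -> Hs Omega s (u - v).
Proof. by move=> Hu Hv; rewrite addrC -scaleN1r; exact: HsZD. Qed.

Lemma Hs_normE u : Hs Omega s u -> Hs_norm Omega s u =
  Num.sqrt (Lnorm_on mu Omega 2%:E u ^+ 2 + Lnorm_on mu2 O2 2%:E (gagliardo u) ^+ 2).
Proof.
move=> /HsP[u2 Gu]; rewrite /Hs_norm /Hs_seminorm Hs_formE.
have -> : pairing mu2 O2 (cst 1) (gagliardo u \* gagliardo u) =
    Lnorm_on mu2 O2 2%:E (gagliardo u) ^+ 2.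
  rewrite (Lnorm_on2 measurable_O2 Gu); apply: eq_Rintegral => z _.
  by rewrite mul1r expr2.
by rewrite sqr_sqrtr ?sqr_ge0.
Qed.

Lemma Lnorm_le_Hs_norm u : Hs Omega s u ->
  Lnorm_on mu2 O2 2%:E (gagliardo u) <= Hs_norm Omega s u.
Proof.
move=> Hu; rewrite Hs_normE// -[leLHS]ger0_norm ?Lnorm_on_ge0// -sqrtr_sqr.
by rewrite ler_sqrt ?lerDr ?sqr_ge0// addr_ge0 ?sqr_ge0.
Qed.

Lemma Hs_norm_ge0 u : 0 <= Hs_norm Omega s u.
Proof. exact: sqrtr_ge0. Qed.

Definition Hs_inner u v := pairing mu Omega v u +
  pairing mu2 O2 (gagliardo v) (gagliardo u).

Lemma Hs_inner_linear w a u v : Hs Omega s w -> Hs Omega s u -> Hs Omega s v ->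
  Hs_inner w (a *: u + v) = a * Hs_inner w u + Hs_inner w v.
Proof.
move=> /HsP[w2 Gw] /HsP[u2 Gu] /HsP[v2 Gv].
rewrite /Hs_inner gagliardoZD !pairingZD//; first ring.
- exact: measurable_O2.
- exact: (cauchy_schwarz_on measurable_O2 Gu Gw).1.
- exact: (cauchy_schwarz_on measurable_O2 Gv Gw).1.
- exact: (cauchy_schwarz_on mO u2 w2).1.
- exact: (cauchy_schwarz_on mO v2 w2).1.
Qed.

Lemma Hs_inner_le w u : Hs Omega s w -> Hs Omega s u ->
  `|Hs_inner w u| <= Hs_norm Omega s w * Hs_norm Omega s u.
Proof.
move=> Hw Hu; have [w2 Gw] := (HsP _).1 Hw; have [u2 Gu] := (HsP _).1 Hu.
rewrite !Hs_normE// -sqrtrM ?addr_ge0 ?sqr_ge0//.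
have [i1 l1] := cauchy_schwarz_on mO u2 w2.
have [i2 l2] := cauchy_schwarz_on measurable_O2 Gu Gw.
apply: le_trans (ler_normD _ _) _.
apply: le_trans (lerD (le_trans (le_normr_Rintegral mO i1) l1)
  (le_trans (le_normr_Rintegral measurable_O2 i2) l2)) _.
set a := Lnorm_on _ _ _ u; set b := Lnorm_on _ _ _ w.
set c := Lnorm_on _ _ _ _; set e := Lnorm_on _ _ _ _.
have [a0 b0 c0 e0] : [/\ 0 <= a, 0 <= b, 0 <= c & 0 <= e] by split; exact: Lnorm_on_ge0.
rewrite -[leLHS]ger0_norm; last by rewrite addr_ge0// mulr_ge0.
rewrite -sqrtr_sqr ler_sqrt; last by rewrite mulr_ge0// addr_ge0 ?sqr_ge0.
(* Lagrange's identity: this square is the difference of the squares of the two sides. *)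
have := sqr_ge0 (a * e - b * c); nra.
Qed.

Lemma Hs_innerE u : Hs Omega s u -> Hs_inner u u = Hs_norm Omega s u ^+ 2.
Proof.
move=> Hu; have [u2 Gu] := (HsP _).1 Hu.
rewrite Hs_normE// sqr_sqrtr ?addr_ge0 ?sqr_ge0//.
rewrite (Lnorm_on2 mO u2) (Lnorm_on2 measurable_O2 Gu) /Hs_inner /pairing.
by congr (_ + _); apply: eq_Rintegral => x _; rewrite expr2.
Qed.

(** The inner product supplies the norming functional: the one with [u_ n], divided by the norm of
    [u_ n], lies in the dual unit ball and takes that norm as its value at [u_ n]. *)
Lemma weak_cvg_Hs_bounded (u_ : nat -> 'rV[R]_N -> R) u :
  (forall n, Hs Omega s (u_ n)) ->
  weak_cvg (Hs Omega s) (Hs_norm Omega s) u_ u ->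
  exists M, forall n, Hs_norm Omega s (u_ n) <= M.
Proof.
move=> Hu_ cu; have [C HC] := weak_cvg_bounded Hu_ cu.
exists `|C| => n; set nu := Hs_norm _ _ _.
have := Hs_norm_ge0 (u_ n); rewrite -/nu le_eqVlt => /predU1P[<-//|nu0].
have := HC n (fun g => nu^-1 * Hs_inner (u_ n) g).
rewrite Hs_innerE// -/nu expr2 mulKf ?gt_eqF// => H.
apply: le_trans (ler_norm _) _; apply: le_trans (H _ _) (ler_norm _).
  by move=> a g h Hg Hh; rewrite Hs_inner_linear//; ring.
move=> g Hg; rewrite normrM gtr0_norm ?invr_gt0// mulrC ler_pdivrMr// mulrC.
exact: Hs_inner_le.
Qed.

(** Each of w(x) and w(y) contributes the L^1 norm of [w] times the volume of [Omega], the other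
    variable being free. *)
Lemma integrable_increment w : (mu Omega < +oo)%E ->
  mu.-integrable Omega (EFin \o w) ->
  mu2.-integrable O2 (EFin \o increment w) /\
  \int[mu2]_(z in O2) `|increment w z| <=
    2 * fine (mu Omega) * \int[mu]_(x in Omega) `|w x|.
Proof.
move=> Ofin iw; have mw : measurable_fun Omega w.
  by apply/measurable_EFinP; exact: (measurable_int _ iw).
have mO2 := measurable_O2.
have Onum : mu Omega \is a fin_num by rewrite ge0_fin_numE.
have m1 : measurable_fun O2 (fun z : 'rV[R]_N * 'rV[R]_N => w z.1).
  apply: (measurable_comp mO) => //; first by move=> _ [z [? ?] <-].
  exact: measurable_funTS.
have m2 : measurable_fun O2 (fun z : 'rV[R]_N * 'rV[R]_N => w z.2).
  apply: (measurable_comp mO) => //; first by move=> _ [z [? ?] <-].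
  exact: measurable_funTS.
have wE : (\int[mu]_(x in Omega) `|w x|%:E = (\int[mu]_(x in Omega) `|w x|)%:E)%E.
  by rewrite /Rintegral fineK//; apply: integrable_fin_num => //; exact: (integrable_norm iw).
have e1 := integral_abs_fst (lebesgue_rV N) (lebesgue_rV N) mO mO mw.
have e2 := integral_abs_snd (lebesgue_rV N) (lebesgue_rV N) mO mO mw.
rewrite wE -(fineK Onum) -EFinM in e1 e2.
have i1 : mu2.-integrable O2 (fun z => (w z.1)%:E).
  apply/integrableP; split; first exact/measurable_EFinP.
  by under eq_integral do rewrite abse_EFin; rewrite e1 ltry.
have i2 : mu2.-integrable O2 (fun z => (w z.2)%:E).
  apply/integrableP; split; first exact/measurable_EFinP.
  by under eq_integral do rewrite abse_EFin; rewrite e2 ltry.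
have iI : mu2.-integrable O2 (EFin \o increment w).
  by have := integrableB mO2 i1 i2; apply: eq_integrable.
split => //; apply: (@le_trans _ _ (\int[mu2]_(z in O2) (`|w z.1| + `|w z.2|))).
  apply: le_Rintegral => //; first exact: (integrable_norm iI).
    exact: (integrableD mO2 (integrable_norm i1) (integrable_norm i2)).
  by move=> z _; exact: ler_normB.
rewrite RintegralD//; [|exact: (integrable_norm i1)|exact: (integrable_norm i2)].
rewrite {1 2}/Rintegral e1 e2 /=; lra.
Qed.

End fractional_Sobolev_theory.

(** * Pairing a weakly with a strongly convergent sequence *)

Section weak_strong_pairing.
Context {d} {T : measurableType d} {R : realType}.
Variables (mu : {measure set T -> \bar R}) (D : set T).
Hypothesis mD : measurable D.
Variables (p q : \bar R).
Hypotheses (p1 : (1 <= p)%E) (q1 : (1 <= q)%E) (pq : (p^-1 + q^-1 = 1)%E).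

Lemma pairing_dual v : Lfun_on mu D q v ->
  dual (Lfun_on mu D p) (Lnorm_on mu D p) (fun f => pairing mu D f v).
Proof.
move=> qv; split=> [a f g pf pg|].
  by apply: pairingZD => //; [exact: (hoelder_on mD p1 q1 pq pf qv).1|
    exact: (hoelder_on mD p1 q1 pq pg qv).1].
by exists (Lnorm_on mu D q v) => f pf; rewrite mulrC; exact: (pairing_le mD p1 q1).
Qed.

Lemma pairing_weak_strong_cvg (f_ v_ : nat -> T -> R) f v :
  (forall n, Lfun_on mu D p (f_ n)) ->
  weak_cvg (Lfun_on mu D p) (Lnorm_on mu D p) f_ f ->
  (forall n, Lfun_on mu D q (v_ n)) -> Lfun_on mu D q v ->
  Lnorm_on mu D q (v_ n - v) @[n --> \oo] --> (0 : R) ->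
  pairing mu D (f_ n) (v_ n) @[n --> \oo] --> pairing mu D f v.
Proof.
move=> pf_ cf qv_ qv cv; have [C HC] := weak_cvg_bounded pf_ cf.
have ifg n w : Lfun_on mu D q w -> mu.-integrable D (EFin \o (f_ n \* w)).
  by move=> qw; exact: (hoelder_on mD p1 q1 pq (pf_ n) qw).1.
(* By Hölder, the pairing with [w] divided by the norm of [w] lies in the unit ball of the dual of
   L^p, where the values at [f_ n] are uniformly bounded. If the norm is 0, Hölder alone gives 0. *)
have le n w : Lfun_on mu D q w ->
    `|pairing mu D (f_ n) w| <= `|C| * Lnorm_on mu D q w.
  move=> qw; have := Lnorm_on_ge0 mu D q w; rewrite le_eqVlt => /predU1P[w0|w0].
    by have := pairing_le mD p1 q1 pq (pf_ n) qw; rewrite -w0 !mulr0.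
  have [lin _] := pairing_dual qw.
  have := HC n (fun g => (Lnorm_on mu D q w)^-1 * pairing mu D g w).
  rewrite normrM gtr0_norm ?invr_gt0// mulrC ler_pdivrMr// => H.
  apply: le_trans (H _ _) _; last by rewrite ler_wpM2r ?ler_norm// ltW.
    by move=> a g h pg ph; rewrite lin//; ring.
  move=> g pg; rewrite normrM gtr0_norm ?invr_gt0// mulrC ler_pdivrMr//.
  exact: pairing_le.
have c0 : pairing mu D (f_ n) (v_ n - v) @[n --> \oo] --> (0 : R).
  apply/cvgr0Pnorm_le => e e0.
  have : `|C| * Lnorm_on mu D q (v_ n - v) @[n --> \oo] --> `|C| * 0 by exact: cvgMr.
  rewrite mulr0 => /cvgr0Pnorm_le/(_ _ e0); apply: filterS => n.
  rewrite ger0_norm ?mulr_ge0 ?Lnorm_on_ge0//; apply: le_trans.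
  by apply: le; exact: Lfun_onB.
have : pairing mu D (f_ n) v + pairing mu D (f_ n) (v_ n - v) @[n --> \oo]
    --> pairing mu D f v + 0.
  by apply: cvgD => //; exact: cf (pairing_dual qv).
rewrite addr0 => c1; apply: cvg_trans c1; apply: near_eq_cvg; apply: nearW => n /=.
by rewrite pairingBr ?subrKC//; exact: ifg.
Qed.

End weak_strong_pairing.

(** * Sign of the form and passage to the limit *)

Lemma pairing_ae_ge0 {d} {T : measurableType d} {R : realType}
    (mu : {measure set T -> \bar R}) (D : set T) (g f : T -> R) :
  measurable D -> measurable_fun D g -> measurable_fun D f ->
  {ae mu, forall x, D x -> 0 <= g x} -> (forall x, 0 <= f x) ->
  0 <= pairing mu D g f.
Proof.
move=> mD mg mf g0 f0; rewrite /pairing /Rintegral.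
rewrite (ae_eq_integral (fun x => `|g x * f x|%:E))//.
- by rewrite fine_ge0// integral_ge0.
- by apply/measurable_EFinP; exact: measurable_funM.
- by apply/measurable_EFinP; apply: measurableT_comp => //; exact: measurable_funM.
- by apply: filterS g0 => x gx Dx; rewrite ger0_norm// mulr_ge0// gx.
Qed.

(** Splitting u_n = u + w_n isolates the weak-star limit, tested on the fixed L^1 function G u * G
    v; the remainder is at most a uniform constant times the L^1 norm of G w_n * G v. *)
Lemma Hs_form_cvg {R : realType} N (Omega : set 'rV[R]_N) (s : R)
    (u_ : nat -> 'rV[R]_N -> R) u v (g_ : nat -> 'rV[R]_N * 'rV[R]_N -> R) g M :
  measurable Omega -> (lebesgue_rV N Omega < +oo)%E ->
  (forall n, Hs Omega s (u_ n)) -> Hs Omega s u -> Hs Omega s v ->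
  (forall n, Hs_norm Omega s (u_ n) <= M) ->
  Lnorm_on (lebesgue_rV N) Omega 1 (u_ n - u) @[n --> \oo] --> (0 : R) ->
  (forall n, Lfun_on (lebesgue_rV2 N) (Omega `*` Omega) +oo%E (g_ n)) ->
  weak_star_cvg (lebesgue_rV2 N) (Omega `*` Omega) g_ g ->
  Hs_form Omega s (g_ n) (u_ n) v @[n --> \oo] --> Hs_form Omega s g u v.
Proof.
move=> mO Ofin Hu_ Hu Hv u_M cu goo cg.
have mO2 : measurable (Omega `*` Omega) by exact: measurable_O2.
have [C HC] := weak_star_cvg_bounded mO2 goo cg.
have [v2 Gv] := (HsP _ mO _).1 Hv; have [u2 Gu] := (HsP _ mO _).1 Hu.
pose w n := u_ n - u.
have Hw n : Hs Omega s (w n) by exact: HsB.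
have Gw n := ((HsP _ mO _).1 (Hw n)).2.
have w1 n : (lebesgue_rV N).-integrable Omega (EFin \o w n).
  have [w2 _] := (HsP _ mO _).1 (Hw n).
  have one : Lfun_on (lebesgue_rV N) Omega 2%:E (cst (1 : R)).
    by apply: (@Lfun_on_bounded_finite _ _ _ _ _ mO _ _ 1) => //;
      rewrite ?lee_fin ?ler1n// => x _; rewrite normr1.
  have := (cauchy_schwarz_on mO w2 one).1.
  by apply: eq_integrable => // x _ /=; rewrite mulr1.
have GwM n : Lnorm_on (lebesgue_rV2 N) (Omega `*` Omega) 2%:E (gagliardo s (w n)) <=
    M + Lnorm_on (lebesgue_rV2 N) (Omega `*` Omega) 2%:E (gagliardo s u).
  have [_ Gun] := (HsP _ mO _).1 (Hu_ n).
  have two : (1 <= 2%:E :> \bar R)%E by rewrite lee_fin ler1n.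
  have -> : gagliardo s (w n) = gagliardo s (u_ n) + (-1) *: gagliardo s u.
    by rewrite scaleN1r -gagliardoB.
  have h := Lnorm_onD mO2 two Gun (Lfun_onZ (-1) two Gu).
  apply: (le_trans h); rewrite Lnorm_onZ// normrN1 mul1r lerD2r.
  exact: le_trans (Lnorm_le_Hs_norm mO (Hu_ n)) (u_M n).
have cI : (\int[lebesgue_rV2 N]_(z in Omega `*` Omega) `|increment (w n) z|)
    @[n --> \oo] --> (0 : R).
  apply/cvgr0Pnorm_le => e e0.
  have : 2 * fine (lebesgue_rV N Omega) * Lnorm_on (lebesgue_rV N) Omega 1 (u_ n - u)
      @[n --> \oo] --> 2 * fine (lebesgue_rV N Omega) * 0 by exact: cvgMr.
  rewrite mulr0 => /cvgr0Pnorm_le/(_ _ e0); apply: filterS => n.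
  rewrite ger0_norm ?mulr_ge0 ?Lnorm_on_ge0// ?fine_ge0// => H.
  rewrite ger0_norm ?Rintegral_ge0//; apply: le_trans H.
  rewrite Lnorm_on1//; exact: (integrable_increment mO Ofin (w1 n)).2.
(* Here [rho] is [sqrt_kernel], the L^1-small factor is the increment of [w n], and [V] is
   [gagliardo s v]; [rho] times the increment unfolds to [gagliardo s (w n)], whose L^2 norm is
   bounded but need not tend to 0. *)
have c0 := weighted_L1_cvg0 mO2 (measurable_funTS (measurable_sqrt_kernel (N := N) s)) Gv
  (fun n => (integrable_increment mO Ofin (w1 n)).1) Gw GwM cI.
have iGw n := (cauchy_schwarz_on mO2 (Gw n) Gv).1.
have iGu := (cauchy_schwarz_on mO2 Gu Gv).1.
have c1 : pairing (lebesgue_rV2 N) (Omega `*` Omega) (g_ n)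
    (gagliardo s (w n) \* gagliardo s v) @[n --> \oo] --> (0 : R).
  apply/cvgr0Pnorm_le => e e0.
  have : C * (\int[lebesgue_rV2 N]_(z in Omega `*` Omega)
      `|gagliardo s (w n) z * gagliardo s v z|) @[n --> \oo] --> C * 0 by exact: cvgMr.
  rewrite mulr0 => /cvgr0Pnorm_le/(_ _ e0); apply: filterS => n /=.
  by move=> /(le_trans (ler_norm _)); apply: le_trans; exact: HC.
have c2 := cg _ ((Lfun_on1P _ mO2 _).2 iGu).
rewrite Hs_formE -[pairing _ _ g _]addr0; apply: cvg_trans (cvgD c2 c1).
apply: near_eq_cvg; apply: nearW => n /=.
have [K _ gK] := Lfun_on_ae_bounded mO2 (goo n).
have mg := Lfun_on_measurable mO2 (goo n).
rewrite Hs_formE !fctE /pairing -RintegralD//.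
- apply: eq_Rintegral => z _ /=; rewrite -mulrDr -mulrDl; congr (_ * (_ * _)).
  by rewrite /w gagliardoB !fctE subrKC.
- exact: (integrable_bounded_mul mO2 mg iGu gK).1.
- exact: (integrable_bounded_mul mO2 mg (iGw n) gK).1.
Qed.

Theorem lemma2p10 (R : realType) (N : nat) (hN : (0 < N)%N)
    (s : R) (hs0 : 0 < s) (hs1 : s < 1)
    (Omega : set 'rV[R]_N) (hOmega : bounded_lipschitz_domain Omega)
    (p q : \bar R) (hp : (1 <= p)%E) (hq : (1 <= q)%E)
    (hpq : (p^-1 + q^-1 = 1)%E)
    (hcompact : compactly_embedded (Hs Omega s) (Hs_norm Omega s)
       (Lfun_on (lebesgue_rV N) Omega q) (Lnorm_on (lebesgue_rV N) Omega q))
    (u_ : nat -> 'rV[R]_N -> R) (u : 'rV[R]_N -> R)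
    (gamma_ : nat -> 'rV[R]_N * 'rV[R]_N -> R)
    (gamma : 'rV[R]_N * 'rV[R]_N -> R)
    (p_ : nat -> 'rV[R]_N -> R) (plim : 'rV[R]_N -> R)
    (hu_ : forall n, Hs Omega s (u_ n)) (hu : Hs Omega s u)
    (hgamma_ : forall n,
       Lfun_on (lebesgue_rV2 N) (Omega `*` Omega) +oo%E (gamma_ n))
    (hgamma_ns : forall n, nonneg_symmetric_ae Omega (gamma_ n))
    (hgamma : Lfun_on (lebesgue_rV2 N) (Omega `*` Omega) +oo%E gamma)
    (hp_ : forall n, Lfun_on (lebesgue_rV N) Omega p (p_ n))
    (hplim : Lfun_on (lebesgue_rV N) Omega p plim)
    (cvg_u : weak_cvg (Hs Omega s) (Hs_norm Omega s) u_ u)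
    (cvg_gamma : weak_star_cvg (lebesgue_rV2 N) (Omega `*` Omega) gamma_ gamma)
    (cvg_p : weak_cvg (Lfun_on (lebesgue_rV N) Omega p)
       (Lnorm_on (lebesgue_rV N) Omega p) p_ plim)
    (heq : forall v, Hs Omega s v -> forall n,
       Hs_form Omega s (gamma_ n) (u_ n) v =
       pairing (lebesgue_rV N) Omega (p_ n) v) :
  (forall v, Hs Omega s v ->
     Hs_form Omega s gamma u v = pairing (lebesgue_rV N) Omega plim v) /\
  Hs_seminorm Omega s (gamma_ n) (u_ n) ^+ 2 @[n --> \oo] -->
    Hs_seminorm Omega s gamma u ^+ 2.
Proof.
have [_ oO _ bO _] := hOmega.
have mO : measurable Omega by exact: open_measurable_rV.
have mO2 : measurable (Omega `*` Omega) by exact: measurable_O2.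
have Ofin : (lebesgue_rV N Omega < +oo)%E by exact: bounded_lebesgue_rV_lty.
have [XY _ _] := hcompact.
have qp : (q^-1 + p^-1 = 1)%E by rewrite addeC.
have [M u_M] := weak_cvg_Hs_bounded mO hu_ cvg_u.
have uq : Lnorm_on (lebesgue_rV N) Omega q (u_ n - u) @[n --> \oo] --> (0 : R).
  apply: (compact_embedding_strong _ _ _ _ hcompact) cvg_u => //.
  - by move=> f g; exact: Lfun_onB.
  - by move=> f; exact: Lnorm_on_ge0.
  - by move=> f g; exact: Lnorm_onD.
  - by move=> g; exact: Lfun_on_separating hpq.
  - by exists M.
(* On a set of finite measure the constant 1 lies in L^p, so Hölder against it bounds the L^1 norm
   by the L^q norm. *)
have u1 : Lnorm_on (lebesgue_rV N) Omega 1 (u_ n - u) @[n --> \oo] --> (0 : R).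
  have one : Lfun_on (lebesgue_rV N) Omega p (cst (1 : R)).
    by apply: (@Lfun_on_bounded_finite _ _ _ _ _ mO _ _ 1) => // x _; rewrite normr1.
  apply/cvgr0Pnorm_le => e e0.
  have : Lnorm_on (lebesgue_rV N) Omega q (u_ n - u) *
      Lnorm_on (lebesgue_rV N) Omega p (cst 1) @[n --> \oo] -->
      0 * Lnorm_on (lebesgue_rV N) Omega p (cst 1) by exact: cvgMl.
  rewrite mul0r => /cvgr0Pnorm_le/(_ _ e0); apply: filterS => n.
  rewrite !ger0_norm ?mulr_ge0 ?Lnorm_on_ge0//; apply: le_trans.
  have uun : Lfun_on (lebesgue_rV N) Omega q (u_ n - u).
    by apply: Lfun_onB => //; exact: XY.
  have := (hoelder_on mO hq hp qp uun one).2.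
  by under eq_Rintegral do rewrite mulr1; rewrite -Lnorm_on1.
have limit v : Hs Omega s v ->
    Hs_form Omega s gamma u v = pairing (lebesgue_rV N) Omega plim v.
  move=> Hv; have c := Hs_form_cvg mO Ofin hu_ hu Hv u_M u1 hgamma_ cvg_gamma.
  have c' := cvg_p _ (pairing_dual mO hp hq hpq (XY _ Hv)).
  have c'' : Hs_form Omega s (gamma_ n) (u_ n) v @[n --> \oo] -->
      pairing (lebesgue_rV N) Omega plim v.
    by under eq_fun do rewrite heq//; exact: c'.
  by rewrite -(cvg_lim _ c)// (cvg_lim _ c'').
split => //.
have form0 n : 0 <= Hs_form Omega s (gamma_ n) (u_ n) (u_ n).
  have [_ Gu] := (HsP _ mO _).1 (hu_ n); have mG := Lfun_on_measurable mO2 Gu.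
  rewrite Hs_formE; apply: pairing_ae_ge0 => //.
  - exact: Lfun_on_measurable (hgamma_ n).
  - exact: measurable_funM.
  - by apply: filterS (hgamma_ns n) => z + Oz => /(_ Oz)[].
  - by move=> z; rewrite /= -expr2 sqr_ge0.
have c : Hs_form Omega s (gamma_ n) (u_ n) (u_ n) @[n --> \oo] --> Hs_form Omega s gamma u u.
  under eq_fun do rewrite heq//.
  rewrite limit//; apply: (pairing_weak_strong_cvg mO hp hq hpq) => //.
  - by move=> n; exact: XY.
  - exact: XY.
(* [Num.sqrt] squares back only on nonnegative numbers; for the limit form the sign is inherited
   from the convergence [c] rather than read off [gamma]. *)
have form_ge0 : 0 <= Hs_form Omega s gamma u u.
  rewrite -(cvg_lim _ c)//; apply: limr_ge; first by apply/cvg_ex; eexists; exact: c.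
  exact: nearW.
rewrite /Hs_seminorm sqr_sqrtr//.
by under eq_fun do rewrite sqr_sqrtr//.
Qed.
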